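(* Let $k,\ell,m,n$ be nonnegative integers with $n\ge2$, $m$ even and $k+\ell+m=n$. The stacked twist map $\theta:\mathrm{Gr}(k,n)\times\mathrm{Gr}(\ell,n)\dashrightarrow\mathrm{Gr}(k,n)\times\mathrm{Gr}(\ell,n)$ preserves the rational top form $\omega_{k,n}\wedge\omega_{\ell,n}$ up to a sign, i.e. $\theta^*(\omega_{k,n}\wedge\omega_{\ell,n})=\pm\,\omega_{k,n}\wedge\omega_{\ell,n}$.
   Context: $\mathrm{Gr}(r,n)$ is the Grassmannian of $r$-dimensional subspaces of $\mathbb R^n$, represented as row spans of full rank $r\times n$ matrices; $\Delta_I$ denotes the maximal minor with column set $I$. Canonical form: $\omega_{r,n}$ is the rational top form on $\mathrm{Gr}(r,n)$, defined up to a sign, which on the chart where $X\in\mathrm{Gr}(r,n)$ is the row span of $[\mathrm{Id}_r\mid A]$, $A=(a_{ij})$ an $r\times(n-r)$ matrix, is $$\omega_{r,n}(X)=\pm\frac{da_{1,1}\wedge da_{1,2}\wedge\dots\wedge da_{r,n-r}}{\prod_{i=1}^n\Delta_{\{i,i+1,\dots,i+r-1\}}([\mathrm{Id}_r\mid A])},$$ with indices modulo $n$. On a product, $\omega_{k,n}\wedge\omega_{\ell,n}$ denotes the wedge of the pullbacks of the forms from the first factor $\mathrm{Gr}(k,n)$ and the second factor $\mathrm{Gr}(\ell,n)$. Stacked twist map: for a $k\times n$ matrix $V$ and an $\ell\times n$ matrix $W$, $U=\mathrm{stack}(V,W)$ is the $(k+\ell)\times n$ matrix with $V$ on top of $W$.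 Extend its columns $U(1),\dots,U(n)$ to all $j\in\mathbb Z$ by $U(j+n)=(-1)^{k-1}U(j)$. Suppose that for all $j\in\mathbb Z$ the vectors $U(j-\ell),\dots,U(j+k-1)$ form a basis of $\mathbb R^{k+\ell}$ (a generic condition). Let $\tilde U=\tau(U)$ be the $(k+\ell)\times n$ matrix with columns $\tilde U(j)$, $1\le j\le n$, where $\tilde U(j)$ is the unique vector with $\langle\tilde U(j),U(j-\ell)\rangle=(-1)^j$ and $\langle\tilde U(j),U(i)\rangle=0$ for $j-\ell+1\le i\le j+k-1$. Let $\tilde W$ be the matrix of the first $k$ rows and $\tilde V$ the matrix of the last $\ell$ rows of $\tilde U$; set $\theta(V,W):=(\tilde W,\tilde V)$. The row spans of $\tilde W,\tilde V$ depend only on those of $V,W$, so $\theta$ is a rational map on pairs of subspaces, with $\tilde W\in\mathrm{Gr}(k,n)$ and $\tilde V\in\mathrm{Gr}(\ell,n)$. *)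

(* Defs.v *)
From mathcomp Require Import all_boot all_order all_algebra all_fingroup.
From mathcomp Require Import all_classical all_reals all_analysis.

Set Implicit Arguments.
Unset Strict Implicit.
Unset Printing Implicit Defensive.

Import Order.TTheory GRing.Theory Num.Theory.
Import numFieldNormedType.Exports.

Local Open Scope classical_set_scope.
Local Open Scope ring_scope.

(** * Differential forms on a normed space

    A differential [N]-form takes a base point and [N] tangent vectors. *)

Definition dform (R : realType) (N : nat) (V : normedModType R) : Type :=
  V -> ('I_N -> V) -> R.

Definition pullback (R : realType) (N : nat) (V W : normedModType R)
    (f : V -> W) (w : dform N W) : dform N V :=
  fun x v => w (f x) (fun i => 'd f x (v i)).

Definition wedge (R : realType) (p q : nat) (V : normedModType R)
    (a : dform p V) (b : dform q V) : dform (p + q) V :=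
  fun x v =>
    (p`! * q`!)%:R^-1 *
    \sum_(s : 'S_(p + q))
       (-1) ^+ s * a x (fun i => v (s (lshift q i)))
                 * b x (fun j => v (s (rshift p j))).

(** * Grassmannian

    [gr_mx r X] is an [r x n] matrix with row span [X] when [X] is in
    [Gr r]. *)

Definition Gr (R : realType) (r n : nat) : set {vspace 'rV[R]_n} :=
  [set X | \dim X = r].

Definition rowspan (R : realType) (r n : nat) (M : 'M[R]_(r, n)) :
    {vspace 'rV[R]_n} :=
  <<[seq row i M | i : 'I_r]>>%VS.

Definition gr_mx (R : realType) (r n : nat) (X : {vspace 'rV[R]_n}) :
    'M[R]_(r, n) :=
  \matrix_(i < r) (vbasis X)`_i.

(** [Delta I M] is the minor of [M] with column set [I], the columns being taken
    in increasing order; it is meant for [#|I| = r]. *)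
Definition Delta (R : realType) (r n : nat) (I : {set 'I_n})
    (M : 'M[R]_(r, n)) : R :=
  \det (conform_mx (0 : 'M[R]_r) (colsub (@enum_val _ (mem I)) M)).

Definition cyc_interval (n : nat) (i : 'I_n) (r : nat) : {set 'I_n} :=
  [set j : 'I_n | [exists t : 'I_r, (j == (i + t) %% n :> nat)%N]]%SET.

(** The matrix [Id_r | A]; [conform_mx] only casts [r + (n - r)] to [n]
    and is meant for [r <= n]. *)
Definition std_mx (R : realType) (r n : nat) (A : 'M[R]_(r, n - r)) :
    'M[R]_(r, n) :=
  conform_mx (0 : 'M[R]_(r, n)) (row_mx 1%:M A).

Definition chart (R : realType) (r n : nat) (A : 'M[R]_(r, n - r)) :
    {vspace 'rV[R]_n} :=
  rowspan (std_mx A).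

(** The inverse of [chart]: [X] is the row span of [Id_r | chart_coord r X]
    whenever [X] lies in the image of [chart]. *)
Definition chart_coord (R : realType) (r n : nat) (X : {vspace 'rV[R]_n}) :
    'M[R]_(r, n - r) :=
  xget 0 [set A : 'M[R]_(r, n - r) | chart A = X].

(** * Canonical form, in the coordinates of [chart] *)

(** The zeros of [cyc_prod] are the poles of the form. One of its factors is
    the minor on the columns 1, ..., r, so the form has a pole all along the
    complement of the image of [chart]: no regular point is lost by working
    in this chart. *)
Definition cyc_prod (R : realType) (r n : nat) (A : 'M[R]_(r, n - r)) : R :=
  \prod_(i < n) Delta (cyc_interval i r) (std_mx A).

(** The determinant is da_{1,1} /\ da_{1,2} /\ ... /\ da_{r,n-r}
    evaluated at [v]: [mxvec] lists the entries of a matrix row by row. *)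
Definition omega (R : realType) (r n : nat) :
    dform (r * (n - r)) 'M[R]_(r, n - r) :=
  fun A v => \det (\matrix_(i, j) mxvec (v i) 0 j) / cyc_prod A.

Definition omega_prod (R : realType) (k l n : nat) :
    dform (k * (n - k) + l * (n - l))
          ('M[R]_(k, n - k) * 'M[R]_(l, n - l))%type :=
  wedge (pullback fst (@omega R k n)) (pullback snd (@omega R l n)).

(** * Stacked twist map *)

(** Column [U(j)] for [j : int], columns being numbered from 1, with
    [U(j + n) = (-1)^(k-1) U(j)]; for [0 < n] the sum has exactly one term. *)
Definition ext_col (R : realType) (k N n : nat) (U : 'M[R]_(N, n)) (j : int) :
    'cV[R]_N :=
  \col_(a < N)
    \sum_(c < n | c%:Z == ((j - 1) %% n%:Z)%Z)
       (-1) ^ ((k%:Z - 1) * ((j - 1) %/ n%:Z)%Z) * U a c.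

Definition dotp (R : realType) (N : nat) (x y : 'cV[R]_N) : R :=
  \sum_(a < N) x a 0 * y a 0.

Definition generic (R : realType) (k l n : nat) (U : 'M[R]_(k + l, n)) : Prop :=
  forall j : int,
    basis_of fullv [seq ext_col k U (j - l%:Z + t%:Z) | t <- iota 0 (k + l)].

Definition twist_col (R : realType) (k l n : nat) (U : 'M[R]_(k + l, n))
    (j : int) : 'cV[R]_(k + l) :=
  xget 0 [set u : 'cV[R]_(k + l) |
            dotp u (ext_col k U (j - l%:Z)) = (-1) ^ j /\
            (forall i : int, j - l%:Z + 1 <= i <= j + k%:Z - 1 ->
               dotp u (ext_col k U i) = 0)].

Definition twist (R : realType) (k l n : nat) (U : 'M[R]_(k + l, n)) :
    'M[R]_(k + l, n) :=
  \matrix_(a < k + l, c < n) twist_col U (c.+1)%:Z a 0.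

Definition stack (R : realType) (k l n : nat)
    (p : {vspace 'rV[R]_n} * {vspace 'rV[R]_n}) : 'M[R]_(k + l, n) :=
  col_mx (gr_mx k p.1) (gr_mx l p.2).

Definition theta_dom (R : realType) (k l n : nat)
    (p : {vspace 'rV[R]_n} * {vspace 'rV[R]_n}) : Prop :=
  [/\ Gr k p.1, Gr l p.2 & generic (stack k l p)].

Definition theta (R : realType) (k l n : nat)
    (p : {vspace 'rV[R]_n} * {vspace 'rV[R]_n}) :
    {vspace 'rV[R]_n} * {vspace 'rV[R]_n} :=
  let T := twist (stack k l p) in (rowspan (usubmx T), rowspan (dsubmx T)).

Definition chart2 (R : realType) (k l n : nat)
    (x : 'M[R]_(k, n - k) * 'M[R]_(l, n - l)) :
    {vspace 'rV[R]_n} * {vspace 'rV[R]_n} :=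
  (chart x.1, chart x.2).

(** The expression of [theta] in the charts. *)
Definition theta_coord (R : realType) (k l n : nat)
    (x : 'M[R]_(k, n - k) * 'M[R]_(l, n - l)) :
    'M[R]_(k, n - k) * 'M[R]_(l, n - l) :=
  let p := theta k l (chart2 x) in (chart_coord k p.1, chart_coord l p.2).

(* Main.v *)
From HB Require Import structures.
Require Import Defs.
From mathcomp Require Import all_boot all_order all_algebra all_fingroup.
From mathcomp Require Import all_classical all_reals all_analysis.
From mathcomp Require Import ring zify.

Set Implicit Arguments.
Unset Strict Implicit.
Unset Printing Implicit Defensive.

Import Order.TTheory GRing.Theory Num.Theory.
Import numFieldNormedType.Exports.

Local Open Scope ring_scope.

(** The form [omega_prod] is the quotient, by the action of GL_k x GL_l on
    stacked matrices U = (V over W), of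

      dU / (cyclic minors of V) (cyclic minors of W),

    which is invariant: under V -> gV both the volume dV and the product of the
    [n] cyclic minors are multiplied by det(g)^n. The twist tau is equivariant,
    tau(gU) = g^-T tau(U), so it suffices to compare its Jacobian, as a map of
    (k+l) x n matrices, with the change of the cyclic minors.

    Let N = k + l, let D_j = det(U(j-l), ..., U(j+k-1)), and let y_j be the
    twisted columns. By definition y_j is orthogonal to the N - 1 columns that
    follow U(j-l) and pairs to a sign with U(j-l), so Gram matrices of
    consecutive twisted columns against consecutive columns of U are triangular
    with signs on the diagonal, or zero ([dotp_twist0], [dotp_twist1]). Hence,
    up to sign,
    - det(y_j, ..., y_(j+N-1)) = 1 / D_j ([det_twist_rows]);
    - the minor of the top [k] rows on y_j, ..., y_(j+k-1) is the minor of W on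
      the [l] columns starting at j-l+k, divided by D_j ([twist_minor_top]);
    - the minor of the bottom [l] rows on y_j, ..., y_(j+l-1) is the minor of V
      on the [k] columns starting at [j], divided by D_j ([twist_minor_bot]).
    Multiplying over a period, tau divides the product of all cyclic minors of
    V and W by the square of the product of the D_j.

    Differentiating the equations <y_j, U(i)> = const of the twist gives
    <dy_j, U(i)> = - <y_j, dU(i)>. Thus dtau is a composition of three maps: in
    each column dU(i), multiplication by the matrix of the twisted columns y_j
    that see U(i); a signed permutation regrouping the pairs (i, j) by [j]; in
    each column [j], multiplication by the inverse of the matrix with
    determinant D_j. By the first item its determinant is, up to sign, the
    inverse of the square of the product of the D_j ([detl_dtwist]), which is
    the factor found for the cyclic minors.

    The descent to the charts is [detl_diff_theta]: in the coordinates in which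
    a tangent vector at U is the sum of a chart direction and of a direction
    along the orbit of GL_k x GL_l, dtau becomes block triangular, with the
    differential of theta in one block and, in the other, minus the transpose
    conjugated by the chart factor of tau(U). Finally a top form in coordinates is
    a constant times a determinant ([omega_prodE]).

    All the signs met on the way depend only on [k], [l] and [n]; the relation
    [eqpm] records this, and it is what makes the final sign uniform. *)

(** * Determinants of endomorphisms *)

Section LinearMaps.
Import VectorInternalTheory.
Variable R : fieldType.
Implicit Types U V W : vectType R.

(** The matrix of a map in the standard coordinates; [f] is a bare function, so
    that determinants of composites and of lambda-terms can be written down
    without packing a linear structure. *)
Definition mxl V W (f : V -> W) : 'M[R]_(dim V, dim W) :=
  \matrix_i v2r (f (r2v (delta_mx 0 i))).

Definition detl V (f : V -> V) : R := \det (mxl f).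

Lemma linear_rowE a b (f : 'rV[R]_a -> 'rV[R]_b) :
  linear f -> forall u, f u = u *m \matrix_i (f (delta_mx 0 i)).
Proof.
move=> lf u.
pose F : {linear 'rV[R]_a -> 'rV[R]_b} :=
  HB.pack f (GRing.isLinear.Build R _ _ *:%R f lf).
transitivity (F u) => //.
rewrite [in LHS](row_sum_delta u) linear_sum mulmx_sum_row.
by apply: eq_bigr => i _; rewrite linearZ /= rowK.
Qed.

Lemma v2r_mxl V W (f : V -> W) : linear f -> forall x, v2r (f x) = v2r x *m mxl f.
Proof.
move=> lf x; pose g u := v2r (f (r2v u)).
have lg : linear g by move=> a u w; rewrite /g !(linearP, lf).
by rewrite -{1}(v2rK x) -/(g (v2r x)) (linear_rowE lg).
Qed.

Lemma mxl_comp U V W (g : V -> W) (f : U -> V) :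
  linear g -> mxl (g \o f) = mxl f *m mxl g.
Proof.
by move=> lg; apply/row_matrixP => i; rewrite rowK row_mul rowK /= (v2r_mxl lg).
Qed.

Lemma eq_mxl V W (f g : V -> W) : f =1 g -> mxl f = mxl g.
Proof. by move=> e; apply/matrixP => i j; rewrite !mxE e. Qed.

Lemma mxl_id V : mxl (@id V) = 1%:M.
Proof. by apply/row_matrixP => i; rewrite rowK r2vK row1. Qed.

Lemma eq_detl V (f g : V -> V) : f =1 g -> detl f = detl g.
Proof. by move=> e; rewrite /detl (eq_mxl e). Qed.

Lemma detl_comp V (g f : V -> V) :
  linear g -> detl (g \o f) = detl g * detl f.
Proof. by move=> lg; rewrite /detl mxl_comp// det_mulmx mulrC. Qed.

Lemma detl_id V : detl (@id V) = 1.
Proof. by rewrite /detl mxl_id det1. Qed.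

(** [p] and [q] are forced to be equal but need not be convertible; this is why
    changes of coordinates are handled through rectangular matrices. *)
Lemma det_conj p q (P : 'M[R]_(p, q)) (Q : 'M[R]_(q, p)) (M : 'M[R]_p) :
  P *m Q = 1%:M -> Q *m P = 1%:M -> \det (Q *m M *m P) = \det M.
Proof.
move=> PQ QP.
have pq : p = q.
  apply/eqP; rewrite eqn_leq.
  have := mxrankM_maxl P Q; rewrite PQ mxrank1 => /leq_trans ->; last exact: rank_leq_col.
  have := mxrankM_maxl Q P; rewrite QP mxrank1 => /leq_trans ->//; exact: rank_leq_col.
case: _ / pq P Q PQ QP => P Q PQ QP.
by rewrite !det_mulmx mulrAC -det_mulmx QP det1 mul1r.
Qed.

(** This lets each determinant below be computed in whichever space presents
    the map in the simplest way. *)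
Lemma detl_conj V W (h : V -> W) (h' : W -> V) (f : V -> V) :
  linear h -> linear h' -> linear f -> cancel h h' -> cancel h' h ->
  detl (h \o f \o h') = detl f.
Proof.
move=> lh lh' lf hK h'K; rewrite /detl.
have -> : mxl (h \o f \o h') = mxl h' *m mxl f *m mxl h.
  have -> : mxl (h \o f \o h') = mxl h' *m mxl (h \o f).
    rewrite -mxl_comp//.
    by move=> a x y /=; rewrite lf lh.
  by rewrite mxl_comp// mulmxA.
apply: det_conj.
  rewrite -mxl_comp//; rewrite -(mxl_id V); exact: eq_mxl.
by rewrite -mxl_comp//; rewrite -(mxl_id W); exact: eq_mxl.
Qed.

Lemma detl_coord V d (c : V -> 'rV[R]_d) (c' : 'rV[R]_d -> V) (f : V -> V)
    (M : 'M[R]_d) :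
  linear c -> linear c' -> linear f -> cancel c c' -> cancel c' c ->
  (forall x, c (f x) = c x *m M) -> detl f = \det M.
Proof.
move=> lc lc' lf cK c'K cf.
rewrite -(detl_conj lc lc' lf cK c'K).
pose h u : 'rV[R]_d := r2v u; pose h' (u : 'rV[R]_d) := v2r u.
rewrite /detl.
have lh : linear h by move=> a x y; rewrite /h linearP.
have lh' : linear h' by move=> a x y; rewrite /h' linearP.
pose P := \matrix_i (h (delta_mx 0 i)) : 'M[R]_(_, d).
pose Q := \matrix_i (h' (delta_mx 0 i)) : 'M[R]_(d, _).
have hE u : h u = u *m P by exact: linear_rowE.
have h'E u : h' u = u *m Q by exact: linear_rowE.
have -> : mxl (c \o f \o c') = P *m M *m Q.
  apply/row_matrixP => i; rewrite rowK !row_mul rowK /= -/h' -/(h' _) cf c'K.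
  by rewrite h'E.
apply: det_conj.
- apply/row_matrixP => i; rewrite row_mul rowK -hE /h /h' v2rK.
  by rewrite row1.
- by apply/row_matrixP => i; rewrite row_mul rowK -h'E /h /h' r2vK row1.
Qed.

Lemma detl_pair V W (f : V * W -> V * W) (f1 : V -> V) :
  linear f -> linear f1 -> (forall x, (f x).1 = f1 x.1) ->
  detl f = detl f1 * detl (fun y => (f (0, y)).2).
Proof.
move=> lf lf1 ff1.
pose f2 y := (f (0, y)).2.
have lf2 : linear f2.
  move=> a x y; rewrite /f2.
  have -> : (0 : V, a *: x + y) = a *: (0, x) + (0, y).
    by apply: injective_projections; rewrite /= ?scaler0 ?addr0.
  by rewrite lf.
pose f21 x := (f (x, 0)).2.
have lf21 : linear f21.
  move=> a x y; rewrite /f21.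
  have -> : (a *: x + y, 0 : W) = a *: (x, 0) + (y, 0).
    by apply: injective_projections; rewrite /= ?scaler0 ?addr0.
  by rewrite lf.
pose c (x : V * W) := row_mx (v2r x.1) (v2r x.2).
pose c' (u : 'rV[R]_(dim V + dim W)) : V * W := (r2v (lsubmx u), r2v (rsubmx u)).
have := @detl_coord _ _ c c' f (block_mx (mxl f1) (mxl f21) 0 (mxl f2)).
rewrite det_ublock; apply => //.
- by move=> a x y; rewrite /c !linearP /= scale_row_mx add_row_mx.
- by move=> a x y; rewrite /c' !linearP.
- by case=> x y; rewrite /c /c' /= row_mxKl row_mxKr !v2rK.
- by move=> u; rewrite /c /c' /= !r2vK hsubmxK.
case=> x y; rewrite /c mul_row_block ff1 /= mulmx0 addr0 (v2r_mxl lf1).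
rewrite -(v2r_mxl lf21) -(v2r_mxl lf2) -linearD /f21 /f2.
congr (row_mx _ (v2r _)).
have -> : (x, y) = 1 *: (x, 0) + (0, y).
  by apply: injective_projections; rewrite /= ?scale1r ?add0r ?addr0.
by rewrite lf scale1r.
Qed.

Lemma detl_pair_snd V W (f : V * W -> V * W) (f2 : W -> W) :
  linear f -> linear f2 -> (forall x, (f x).2 = f2 x.2) ->
  detl f = detl f2 * detl (fun x => (f (x, 0)).1).
Proof.
move=> lf lf2 ff2.
pose sw (x : V * W) : W * V := (x.2, x.1); pose sw' (x : W * V) : V * W := (x.2, x.1).
have ls : linear sw by move=> a x y.
have ls' : linear sw' by move=> a x y.
rewrite -(detl_conj ls ls' lf); [|by case|by case].
rewrite (@detl_pair _ _ _ f2)// => [|[x y] /=]; last exact: ff2.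
by move=> a x y; rewrite /= ls' lf ls.
Qed.

Lemma detl_mulmxr p (M : 'M[R]_p) : detl (fun u : 'rV[R]_p => u *m M) = \det M.
Proof.
apply: (@detl_coord _ _ id id) => //.
by move=> a x y /=; rewrite mulmxDl scalemxAl.
Qed.

Lemma detl_dim0 V (f : V -> V) : dim V = 0%N -> detl f = 1.
Proof.
by rewrite /detl; move: (mxl f) => M d0; move: M; rewrite d0 => M; rewrite det_mx00.
Qed.

Definition rowwise m p (B : 'I_m -> 'M[R]_p) (X : 'M[R]_(m, p)) : 'M[R]_(m, p) :=
  \matrix_i (row i X *m B i).

Lemma rowwise_linear m p (B : 'I_m -> 'M[R]_p) : linear (rowwise B).
Proof.
by move=> a x y; apply/row_matrixP => i; rewrite rowK !linearP /= !rowK mulmxDl scalemxAl.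
Qed.

(** Splitting off the first row turns the map into a block diagonal one. *)
Lemma detl_rowwise m p (B : 'I_m -> 'M[R]_p) :
  detl (rowwise B) = \prod_i \det (B i).
Proof.
elim: m B => [|m IHm] B.
  by rewrite big_ord0 detl_dim0//; exact: mul0n.
pose h (X : 'M[R]_(1 + m, p)) := (usubmx X, dsubmx X) : 'rV[R]_p * 'M[R]_(m, p).
pose h' (x : 'rV[R]_p * 'M[R]_(m, p)) : 'M[R]_(1 + m, p) := col_mx x.1 x.2.
have lh : linear h by move=> a x y; rewrite /h !linearP.
have lh' : linear h' by move=> a x y; rewrite /h' scale_col_mx add_col_mx.
have hK : cancel h h' by move=> x; rewrite /h /h' vsubmxK.
have h'K : cancel h' h by case=> x y; rewrite /h /h' col_mxKu col_mxKd.
rewrite -(@detl_conj _ _ h h' (rowwise B)) ?big_ord_recl//; last exact: rowwise_linear.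
rewrite (@detl_pair _ _ _ (fun u => u *m B ord0)).
- congr (_ * _); first exact: detl_mulmxr.
  rewrite -IHm; apply: eq_detl => Y; apply/row_matrixP => i /=.
  rewrite row_dsubmx !rowK /h'; congr (_ *m B _); last exact/val_inj.
  exact: rowKd.
- rewrite -[h \o _ \o _]/(h \o (rowwise B \o h')).
  by move=> a x y /=; rewrite lh' rowwise_linear lh.
- by move=> a x y /=; rewrite mulmxDl scalemxAl.
case=> x y /=; apply/row_matrixP => i; rewrite row_usubmx rowK.
rewrite ord1 row_id; congr (_ *m B _); last exact/val_inj.
exact: etrans (rowKu 0 x y) (row_id 0 x).
Qed.

Lemma detl_mulmx_right m p (B : 'M[R]_p) :
  detl (fun X : 'M[R]_(m, p) => X *m B) = \det B ^+ m.
Proof.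
rewrite -[m in RHS]card_ord -prodr_const -(detl_rowwise (fun=> B)).
by apply: eq_detl => X; apply/row_matrixP => i; rewrite rowK row_mul.
Qed.

Lemma detl_trmx_conj m p (f : 'M[R]_(m, p) -> 'M[R]_(m, p)) : linear f ->
  detl (fun X => (f X^T)^T) = detl f.
Proof.
move=> lf.
by rewrite -(@detl_conj _ _ (@trmx R m p) (@trmx R p m) f)// => [a x y|a x y|x|x];
  rewrite ?linearP ?trmxK.
Qed.

Lemma detl_mulmx_left p m (B : 'M[R]_p) :
  detl (fun X : 'M[R]_(p, m) => B *m X) = \det B ^+ m.
Proof.
have l : linear (fun X : 'M[R]_(m, p) => X *m B^T).
  by move=> a x y; rewrite mulmxDl scalemxAl.
rewrite -det_tr -detl_mulmx_right -(detl_trmx_conj l).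
by apply: eq_detl => X; rewrite trmx_mul !trmxK.
Qed.

Lemma detl_invol V (f : V -> V) : linear f -> involutive f -> detl f ^+ 2 = 1.
Proof.
by move=> lf ff; rewrite expr2 -detl_comp// -(detl_id V); exact: eq_detl.
Qed.

End LinearMaps.

(** * Endomorphisms of determinant 1 or -1 *)

Section SignedPermutations.
Variable R : realFieldType.

Lemma sqr_eq1_of_expr_eq1 (x : R) n : (0 < n)%N -> x ^+ n = 1 -> x ^+ 2 = 1.
Proof.
move=> n0 xn1; have /eqP : `|x| ^+ n = 1 by rewrite -normrX xn1 normr1.
by rewrite pexpr_eq1// => /eqP x1; rewrite -real_normK ?num_real// x1 expr1n.
Qed.

Definition perm_entries m p (s : 'I_m * 'I_p -> 'I_m * 'I_p) (X : 'M[R]_(m, p)) :=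
  \matrix_(i, j) X (s (i, j)).1 (s (i, j)).2.

Lemma perm_entries_linear m p s : linear (@perm_entries m p s).
Proof. by move=> a x y; apply/matrixP => i j; rewrite !mxE. Qed.

(** Composition with a permutation of finite order is an endomorphism of finite
    order, and the only roots of unity in an ordered field are 1 and -1. *)
Lemma detl_perm_entries m p s : injective s ->
  detl (@perm_entries m p s) ^+ 2 = 1.
Proof.
move=> s_inj; pose t := perm s_inj.
apply: (@sqr_eq1_of_expr_eq1 _ #[t]%g); first exact: order_gt0.
have -> : detl (@perm_entries m p s) = detl (@perm_entries m p t).
  by apply: eq_detl => X; apply/matrixP => i j; rewrite !mxE permE.
suff pw N : detl (@perm_entries m p t) ^+ N = detl (@perm_entries m p (t ^+ N)%g).
  rewrite pw expg_order -[RHS](detl_id 'M[R]_(m, p)); apply: eq_detl => X.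
  by apply/matrixP => i j; rewrite !mxE perm1.
elim: N => [|N IH].
  rewrite expr0 expg0 -[LHS](detl_id 'M[R]_(m, p)); apply: eq_detl => X.
  by apply/matrixP => i j; rewrite !mxE perm1.
rewrite exprS IH -detl_comp; last exact: perm_entries_linear.
apply: eq_detl => X; apply/matrixP => i j; rewrite expgS !mxE permM.
by case: (t _).
Qed.

Definition sign_entries m p (e : 'I_m -> 'I_p -> R) (X : 'M[R]_(m, p)) :=
  \matrix_(i, j) (e i j * X i j).

Lemma sign_entries_linear m p e : linear (@sign_entries m p e).
Proof. by move=> a x y; apply/matrixP => i j; rewrite !mxE mulrDr mulrCA. Qed.

Lemma detl_sign_entries m p e : (forall i j, e i j ^+ 2 = 1) ->
  detl (@sign_entries m p e) ^+ 2 = 1.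
Proof.
move=> e1; apply: detl_invol; first exact: sign_entries_linear.
by move=> X; apply/matrixP => i j; rewrite !mxE mulrA -expr2 e1 mul1r.
Qed.

(** The inverse of the left multiplication by [G] cancels the right
    multiplication by [G], so that only the determinant of the involution
    [- g^T] remains. *)
Lemma detl_conj_trmx p : exists2 e : R, e ^+ 2 = 1 &
  forall G : 'M[R]_p, G \in unitmx ->
  detl (fun g => - (invmx G *m g^T *m G)) = e.
Proof.
have l0 : linear (fun g : 'M[R]_p => - g^T).
  by move=> a x y /=; rewrite linearP /= opprD scalerN.
exists (detl (fun g : 'M[R]_p => - g^T)).
  by apply: detl_invol => // g; apply/matrixP => i j; rewrite !mxE opprK.
move=> G uG.
have := @detl_comp _ _ (fun g : 'M[R]_p => invmx G *m g) ((mulmx^~ G) \o (fun g => - g^T)).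
have := @detl_comp _ _ (fun g : 'M[R]_p => g *m G) (fun g => - g^T).
rewrite detl_mulmx_right detl_mulmx_left.
move=> H1 H2; rewrite -[RHS]mul1r -(expr1n R p) -(mulVr (_ : \det G \is a GRing.unit))//.
rewrite exprMn -mulrA -det_inv -H1; last by move=> a x y /=; rewrite mulmxDl scalemxAl.
rewrite -H2; last by move=> a x y /=; rewrite mulmxDr scalemxAr.
by apply: eq_detl => g /=; rewrite mulNmx mulmxN mulmxA.
Qed.

End SignedPermutations.

(** * Entrywise differentiation of matrix-valued maps *)

Section Calculus.
Variables (R : realType) (E : normedModType R).

(** Differentials only see germs. The chart expression of [theta] goes through
    choices that are controlled at regular points only, hence this form. *)
Lemma is_diff_near (F : normedModType R) (f g df : E -> F) (x : E) :
  (\near x, f x = g x) -> is_diff x f df -> is_diff x g df.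
Proof.
move=> fg [fx fdf].
have gE : g \o shift x = cst (g x) + 'd f x +o_ (0 : E) id.
  have := diff_locally fx => /eqaddoP H; apply/eqaddoP => e e0.
  have := H e e0; apply: filterS2; last first.
    move: fg; rewrite (near_shift 0 x) /=; apply.
  have fgx : f x = g x by exact: (nbhs_singleton fg).
  by move=> h /=; rewrite subr0 !fctE /= fgx => ->.
have gd : 'd g x = 'd f x :> (E -> F).
  by apply: diff_unique => //; exact: diff_continuous.
apply: DiffDef; last by rewrite gd.
by apply/diff_locallyP; rewrite gd; split => //; exact: diff_continuous.
Qed.

Lemma is_diff_linear (F : normedModType R) (f : E -> F) (x : E) :
  linear f -> continuous f -> is_diff x f f.
Proof.
move=> lf cf; pose L : {linear E -> F} := HB.pack f (GRing.isLinear.Build R _ _ *:%R f lf).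
apply: DiffDef; first exact: (@linear_differentiable _ _ _ L).
exact: (@diff_lin _ _ _ L).
Qed.

Lemma is_diff_bigsum (F : normedModType R) (I : Type) (r : seq I) (P : pred I)
    (f df : I -> E -> F) x : (forall i, is_diff x (f i) (df i)) ->
  is_diff x (fun y => \sum_(i <- r | P i) f i y) (fun v => \sum_(i <- r | P i) df i v).
Proof.
move=> fd; elim: r => [|i r IH].
  under eq_fun do rewrite big_nil.
  under [X in is_diff _ _ X]eq_fun do rewrite big_nil.
  exact: is_diff_cst.
under eq_fun do rewrite big_cons.
under [X in is_diff _ _ X]eq_fun do rewrite big_cons.
by case: (P i) => //; exact: is_diffD.
Qed.

Lemma differentiable_bigprod (I : Type) (r : seq I) (P : pred I)
    (f : I -> E -> R) x : (forall i, differentiable (f i) x) ->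
  differentiable (fun y => \prod_(i <- r | P i) f i y) x.
Proof.
move=> fd; elim: r => [|i r IH].
  by under eq_fun do rewrite big_nil; exact: differentiable_cst.
under eq_fun do rewrite big_cons.
by case: (P i) => //; exact: differentiableM.
Qed.

Lemma differentiable_bigsum (F : normedModType R) (I : Type) (r : seq I) (P : pred I)
    (f : I -> E -> F) x : (forall i, differentiable (f i) x) ->
  differentiable (fun y => \sum_(i <- r | P i) f i y) x.
Proof.
move=> fd; have [] // := @is_diff_bigsum F I r P f (fun i => 'd (f i) x) x _.
Qed.

(** Differentials are computed on entries, where the calculus of real-valued
    functions applies; [is_diff_of_is_mdiff] recovers the Frechet differential. *)
Definition is_mdiff p q (x : E) (f df : E -> 'M[R]_(p, q)) : Prop :=
  forall i j, is_diff x (fun y => f y i j) (fun v => df v i j).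

Definition mdifferentiable p q (f : E -> 'M[R]_(p, q)) (x : E) : Prop :=
  forall i j, differentiable (fun y => f y i j) x.

Lemma mdifferentiableP p q (f : E -> 'M[R]_(p, q)) x : mdifferentiable f x ->
  is_mdiff x f (fun v => \matrix_(i, j) 'd (fun y => f y i j) x v).
Proof.
move=> fd i j; under [X in is_diff _ _ X]eq_fun do rewrite mxE.
exact: differentiableP.
Qed.

Lemma is_mdiff_of_is_diff p q (f df : E -> 'M[R]_(p, q)) x : is_diff x f df -> is_mdiff x f df.
Proof.
move=> fd i j; pose c (M : 'M[R]_(p, q)) := M i j.
have lc : linear c by move=> a M N; rewrite /c !mxE.
pose L : {linear _ -> R} := HB.pack c (GRing.isLinear.Build R _ _ *:%R c lc).
have cd : is_diff (f x) c c.
  apply: DiffDef; first exact: differentiable_coord.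
  by apply: (@diff_lin _ _ _ L); exact: coord_continuous.
exact: (is_diff_comp fd cd).
Qed.

(** A matrix-valued map is a finite combination of constant matrices whose
    coefficients are its entries. *)
Lemma is_diff_of_is_mdiff p q (f df : E -> 'M[R]_(p, q)) x : is_mdiff x f df -> is_diff x f df.
Proof.
move=> fd; have fx : differentiable f x.
  rewrite (_ : f = fun y => \sum_i \sum_j f y i j *: delta_mx i j); last first.
    by apply/funext => y; exact: matrix_sum_delta.
  apply: differentiable_bigsum => i; apply: differentiable_bigsum => j.
  by apply: differentiableZl; have [] := fd i j.
apply: DiffDef => //; apply/funext => v; apply/matrixP => i j.
have [_ e] := fd i j; have [_ e'] := is_mdiff_of_is_diff (differentiableP fx) i j.
by rewrite -[RHS]/((fun v => df v i j) v) -e e'.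
Qed.

Lemma is_mdiff_unique p q (f df df' : E -> 'M[R]_(p, q)) x :
  is_mdiff x f df -> is_mdiff x f df' -> df = df'.
Proof.
move=> fd fd'; apply/funext => v; apply/matrixP => i j.
have [_ e] := fd i j; have [_ e'] := fd' i j.
by rewrite -[LHS]/((fun v => df v i j) v) -e e'.
Qed.

Lemma is_mdiff_near p q (f g df : E -> 'M[R]_(p, q)) x :
  (\near x, f x = g x) -> is_mdiff x f df -> is_mdiff x g df.
Proof.
move=> fg fd; apply: is_mdiff_of_is_diff; apply: is_diff_near fg _.
exact: is_diff_of_is_mdiff.
Qed.

Lemma is_mdiff_cst p q (M : 'M[R]_(p, q)) x : is_mdiff x (fun=> M) (fun=> 0).
Proof.
move=> i j; under [X in is_diff _ _ X]eq_fun do rewrite mxE.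
exact: is_diff_cst.
Qed.

Lemma is_mdiff_mulmx p q r (f df : E -> 'M[R]_(p, q)) (g dg : E -> 'M[R]_(q, r)) x :
  is_mdiff x f df -> is_mdiff x g dg ->
  is_mdiff x (fun y => f y *m g y) (fun v => df v *m g x + f x *m dg v).
Proof.
move=> fd gd i j.
under eq_fun do rewrite mxE.
under [X in is_diff _ _ X]eq_fun do rewrite !mxE -big_split /=.
apply: is_diff_bigsum => s.
have := is_diffM (fd i s) (gd s j).
rewrite (_ : _ + _ = fun v => df v i s * g x s j + f x i s * dg v s j) //.
by apply/funext => v; rewrite !fctE /= addrC [g x s j *: _]mulrC.
Qed.

Lemma is_mdiff_entries p q p' q' (s : 'I_p' -> 'I_p) (t : 'I_q' -> 'I_q)
    (f df : E -> 'M[R]_(p, q)) x :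
  is_mdiff x f df -> is_mdiff x (fun y => mxsub s t (f y)) (fun v => mxsub s t (df v)).
Proof.
move=> fd i j; under eq_fun do rewrite mxE.
by under [X in is_diff _ _ X]eq_fun do rewrite mxE.
Qed.

Lemma mdifferentiable_det p (f : E -> 'M[R]_p) x : mdifferentiable f x ->
  differentiable (fun y => \det (f y)) x.
Proof.
move=> fd; apply: differentiable_bigsum => s.
by apply: differentiableM; [exact: differentiable_cst|exact: differentiable_bigprod].
Qed.

Lemma mdifferentiable_mulmx p q r (f : E -> 'M[R]_(p, q)) (g : E -> 'M[R]_(q, r)) x :
  mdifferentiable f x -> mdifferentiable g x ->
  mdifferentiable (fun y => f y *m g y) x.
Proof.
move=> /mdifferentiableP fd /mdifferentiableP gd i j.
by have [] := is_mdiff_mulmx fd gd i j.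
Qed.

(** Near a unit the inverse is given by Cramer's rule. *)
Lemma mdifferentiable_invmx p (f : E -> 'M[R]_p) x : f x \in unitmx ->
  mdifferentiable f x -> mdifferentiable (fun y => invmx (f y)) x.
Proof.
move=> ufx fd i j.
have dx0 : \det (f x) != 0 by move: ufx; rewrite unitmxE unitfE.
have dd := mdifferentiable_det fd.
have h : differentiable (fun y => (\det (f y))^-1 * cofactor (f y) j i) x.
  apply: differentiableM; first exact: differentiableV.
  apply: differentiableM; first exact: differentiable_cst.
  apply: mdifferentiable_det => a b.
  by under eq_fun do rewrite !mxE; exact: fd.
suff nf : \near x, (\det (f x))^-1 * cofactor (f x) j i = invmx (f x) i j.
  by have [] := is_diff_near nf (differentiableP h).
have : \near x, \det (f x) != 0.
  have c := differentiable_continuous dd.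
  exact: (c _ (open_nbhs_nbhs (conj (@open_neq R 0) dx0))).
apply: filterS => y dy0.
by rewrite /invmx unitmxE unitfE dy0 !mxE.
Qed.

End Calculus.

(** * Equality up to a constant sign *)

Section EqPm.
Variables (R : realType) (T : Type) (P : T -> Prop).
Implicit Types f g h : T -> R.

(** The point is the order of the quantifiers: the sign is chosen before the
    point [x]. *)
Definition eqpm f g := exists2 e : R, e ^+ 2 = 1 & forall x, P x -> f x = e * g x.

Lemma eqpm_refl f : eqpm f f.
Proof. by exists 1; [rewrite expr1n|move=> x _; rewrite mul1r]. Qed.

Lemma eqpm_eq f g : (forall x, P x -> f x = g x) -> eqpm f g.
Proof. by move=> fg; exists 1; [rewrite expr1n|move=> x /fg; rewrite mul1r]. Qed.

Lemma eqpm_sym f g : eqpm f g -> eqpm g f.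
Proof.
move=> [e e1 fg]; exists e => // x Px.
by rewrite fg// mulrA -expr2 e1 mul1r.
Qed.

Lemma eqpm_trans g f h : eqpm f g -> eqpm g h -> eqpm f h.
Proof.
move=> [e e1 fg] [e' e'1 gh]; exists (e * e'); first by rewrite exprMn e1 e'1 mulr1.
by move=> x Px; rewrite fg// gh// mulrA.
Qed.

Lemma eqpm_mul f g f' g' : eqpm f g -> eqpm f' g' ->
  eqpm (fun x => f x * f' x) (fun x => g x * g' x).
Proof.
move=> [e e1 fg] [e' e'1 fg']; exists (e * e'); first by rewrite exprMn e1 e'1 mulr1.
by move=> x Px; rewrite fg// fg'// mulrACA.
Qed.

Lemma eqpm_prod (I : finType) (f g : I -> T -> R) : (forall i, eqpm (f i) (g i)) ->
  eqpm (fun x => \prod_i f i x) (fun x => \prod_i g i x).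
Proof.
move=> fg; have [e eP fP] := fin_all_exists2 fg.
exists (\prod_i e i); first by rewrite -prodrXl big1.
by move=> x Px; rewrite -big_split; apply: eq_bigr => i _; exact: fP.
Qed.
End EqPm.

Lemma eqpm_comp (R : realType) (S T : Type) (P : T -> Prop) (Q : S -> Prop)
    (h : S -> T) (f g : T -> R) :
  (forall x, Q x -> P (h x)) -> eqpm P f g -> eqpm Q (f \o h) (g \o h).
Proof. by move=> QP [e e1 fg]; exists e => // x /QP /fg. Qed.

Lemma sign_neq0 (R : realType) (e : R) : e ^+ 2 = 1 -> e != 0.
Proof. by move=> e1; rewrite -sqrf_eq0 e1 oner_eq0. Qed.

Lemma sqr_sign (R : unitRingType) (j : int) : ((-1) ^ j : R) ^+ 2 = 1.
Proof.
case: j => m; first exact: sqrr_sign.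
by rewrite -[(-1) ^ _]/((-1) ^- m.+1) exprVn sqrr_sign invr1.
Qed.

(** Moving the range by one replaces the first factor by its translate by a
    period, which only contributes [d]. *)
Lemma prod_shift (R : realType) (n : nat) (d : R) (a : int) :
  (0 < n)%N -> d ^+ 2 = 1 ->
  exists2 e : R, e ^+ 2 = 1 &
  forall f : int -> R, (forall j, f (j + n%:Z) = d * f j) ->
  \prod_(i < n) f (i%:Z + a) = e * \prod_(i < n) f i%:Z.
Proof.
case: n => // n _ d1.
have pos (m : nat) (f : int -> R) : (forall j, f (j + n.+1%:Z) = d * f j) ->
    \prod_(i < n.+1) f (i%:Z + m%:Z) = d ^+ m * \prod_(i < n.+1) f i%:Z.
  move=> fn; elim: m => [|m IH].
    by rewrite expr0 mul1r; apply: eq_bigr => i _; rewrite addr0.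
  rewrite exprS -mulrA -IH.
  rewrite big_ord_recr /= [in RHS]big_ord_recl /=.
  have -> : n%:Z + m.+1%:Z = (0 + m%:Z) + n.+1%:Z by lia.
  rewrite fn mulrCA; congr (_ * _); rewrite mulrC; congr (_ * _).
  by apply: eq_bigr => i _; congr f; rewrite /bump /=; lia.
exists (d ^+ `|a|); first by rewrite exprAC d1 expr1n.
move=> f fn; case: a => m; first exact: pos.
have := pos m.+1 (fun j => f (j + Negz m)).
rewrite (eq_bigr (fun i : 'I_n.+1 => f i%:Z)); last first.
  by move=> i _; congr f; rewrite NegzE; lia.
move=> ->; last by move=> j; rewrite -fn; congr f; lia.
by rewrite mulrA -exprD addnn -mul2n exprM d1 expr1n mul1r.
Qed.

Lemma antiperiodicZ (R : realType) (V : lmodType R) (n : nat) (d : R) (f : int -> V)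
    (j q : int) :
  d ^+ 2 = 1 -> (forall j : int, f (j + n%:Z) = d *: f j) ->
  f (j + q * n%:Z) = d ^+ `|q| *: f j.
Proof.
move=> d1 fn.
have pos (m : nat) i : f (i + m%:Z * n%:Z) = d ^+ m *: f i.
  elim: m => [|m IH]; first by rewrite mul0r addr0 scale1r.
  have -> : i + m.+1%:Z * n%:Z = (i + m%:Z * n%:Z) + n%:Z by lia.
  by rewrite fn IH scalerA exprS.
case: q => m; first exact: pos.
have := pos m.+1 (j + Negz m * n%:Z).
have -> : j + Negz m * n%:Z + m.+1%:Z * n%:Z = j by rewrite NegzE; lia.
by move=> ->; rewrite scalerA -exprD addnn -mul2n exprM d1 expr1n scale1r.
Qed.

(** * Windows of consecutive columns *)

Section Windows.
Variables (R : realType) (k n : nat) (n0 : (0 < n)%N).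

Fact col_index_subproof (j : int) : (`|((j - 1) %% n%:Z)%Z| < n)%N.
Proof. by have := @ltz_pmod (j - 1) n%:Z; lia. Qed.

Definition col_index (j : int) : 'I_n := Ordinal (col_index_subproof j).

Definition col_sign (j : int) : R := (-1) ^ ((k%:Z - 1) * ((j - 1) %/ n%:Z)%Z).

Lemma col_sign_sqr j : col_sign j ^+ 2 = 1.
Proof. exact: sqr_sign. Qed.

Lemma ext_colE N (U : 'M[R]_(N, n)) j :
  ext_col k U j = col_sign j *: col (col_index j) U.
Proof.
apply/colP => a; rewrite !mxE (big_pred1 (col_index j)) // => c.
rewrite /= -val_eqE /=; have := @modz_ge0 (j - 1) n%:Z; lia.
Qed.

Lemma col_indexD j : col_index (j + n%:Z) = col_index j.
Proof. by apply: val_inj; rewrite /= addrAC modzDr. Qed.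

Lemma col_signD j : col_sign (j + n%:Z) = (-1) ^ (k%:Z - 1) * col_sign j.
Proof.
have nz : n%:Z != 0 by lia.
rewrite /col_sign (_ : j + n%:Z - 1 = 1 * n%:Z + (j - 1)); last by lia.
by rewrite divzMDl// mulrDr mulr1 expfzDr ?oppr_eq0 ?oner_eq0.
Qed.

Lemma ext_col_mulmx N N' (g : 'M[R]_(N', N)) (U : 'M[R]_(N, n)) j :
  ext_col k (g *m U) j = g *m ext_col k U j.
Proof. by rewrite !ext_colE -scalemxAr; congr (_ *: _); rewrite !colE mulmxA. Qed.

(** The period sign of the extended columns is always the one of the ambient
    [k], also for the blocks of [U] taken separately; their windows then stack
    to the windows of [U]. *)
Definition window N (U : 'M[R]_(N, n)) (j : int) r : 'M[R]_(N, r) :=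
  \matrix_(a, b) ext_col k U (j + b%:Z) a 0.

Lemma windowE N (U : 'M[R]_(N, n)) j r a b :
  @window N U j r a b = col_sign (j + b%:Z) * U a (col_index (j + b%:Z)).
Proof. by rewrite mxE ext_colE !mxE. Qed.

Lemma window_mulmx N N' (g : 'M[R]_(N', N)) (U : 'M[R]_(N, n)) j r :
  window (g *m U) j r = g *m window U j r.
Proof.
apply/matrixP => a b; rewrite mxE ext_col_mulmx !mxE.
by apply: eq_bigr => c _; rewrite !mxE.
Qed.

Lemma window_col_mx p q (V : 'M[R]_(p, n)) (W : 'M[R]_(q, n)) j r :
  window (col_mx V W) j r = col_mx (window V j r) (window W j r).
Proof.
apply/matrixP => a b; rewrite windowE.
by case: (split_ordP a) => c ->;
  rewrite ?(col_mxEu, col_mxEd) windowE.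
Qed.

Definition wdet r (U : 'M[R]_(r, n)) j := \det (window U j r).

(** Up to sign the product of all cyclic minors ([prod_Delta_cyc]), with factors
    that make sense at every integer. *)
Definition wprod r (U : 'M[R]_(r, n)) : R := \prod_(i < n) wdet U i%:Z.

Lemma wdetD r (U : 'M[R]_(r, n)) j :
  wdet U (j + n%:Z) = ((-1) ^ (k%:Z - 1)) ^+ r * wdet U j.
Proof.
rewrite /wdet -detZ; congr (\det _); apply/matrixP => a b.
by rewrite windowE [RHS]mxE windowE addrAC col_signD col_indexD mulrA.
Qed.

Lemma wprod_neq0P r (M : 'M[R]_(r, n)) :
  wprod M != 0 <-> (forall j : int, wdet M j != 0).
Proof.
split=> [/prodf_neq0 M0 j|M0]; last by apply/prodf_neq0 => i _; exact: M0.
have d1 : (((-1) ^ (k%:Z - 1)) ^+ r : R) ^+ 2 = 1 by rewrite exprAC sqr_sign expr1n.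
have nz : n%:Z != 0 by lia.
have jn : (absz (j %% n%:Z)%Z < n)%N by have := ltz_pmod j (_ : 0 < n%:Z); lia.
have jE : j = (absz (j %% n%:Z)%Z)%:Z + (j %/ n%:Z)%Z * n%:Z.
  by have := divz_eq j n%:Z; have := modz_ge0 j nz; lia.
rewrite jE (@antiperiodicZ R R^o n _ (wdet M) _ _ d1); last by move=> i; exact: wdetD.
rewrite scaler_eq0 negb_or (M0 (Ordinal jn))// andbT.
by rewrite expf_neq0// sign_neq0.
Qed.

End Windows.

(** * Cyclic minors *)

Section CyclicMinors.
Variables (R : realType) (n : nat).

Lemma cyc_subproof (i : 'I_n) (b : nat) : ((i + b) %% n < n)%N.
Proof. by rewrite ltn_mod; case: n i => [[]|]. Qed.

Definition cyc (i : 'I_n) (b : nat) : 'I_n := Ordinal (cyc_subproof i b).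

Lemma cyc_inj r (i : 'I_n) : (r <= n)%N -> injective (fun b : 'I_r => cyc i b).
Proof.
move=> rn b c /(congr1 val) /= /eqP; rewrite eqn_modDl !modn_small.
- by move/eqP/val_inj.
- exact: leq_trans (ltn_ord _) rn.
- exact: leq_trans (ltn_ord _) rn.
Qed.

Lemma cyc_intervalE r (i : 'I_n) :
  cyc_interval i r = [set cyc i b | b : 'I_r]%SET.
Proof.
apply/setP => j; rewrite inE; apply/existsP/imsetP => [[t /eqP jt]|[t _ ->]].
  by exists t => //; apply: val_inj.
by exists t.
Qed.

Lemma card_cyc_interval r (i : 'I_n) : (r <= n)%N -> #|cyc_interval i r| = r.
Proof. by move=> rn; rewrite cyc_intervalE card_imset ?card_ord//; exact: cyc_inj. Qed.

Lemma DeltaE r (I : {set 'I_n}) (M : 'M[R]_(r, n)) (e : #|I| = r) :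
  Delta I M = \det (\matrix_(a < r, b < r) M a (enum_val (cast_ord (esym e) b))).
Proof.
rewrite /Delta; case: r / e M => M; rewrite conform_mx_id; congr (\det _).
by apply/matrixP => a b; rewrite !mxE; congr (M _ (enum_val _)); apply: val_inj.
Qed.

(** The sign [e] comes from sorting the columns of the interval and from the
    signs [d], and not from [M]. *)
Lemma Delta_cyc r (i : 'I_n) (d : 'I_r -> R) : (r <= n)%N ->
  (forall b, d b ^+ 2 = 1) ->
  exists2 e : R, e ^+ 2 = 1 & forall M : 'M[R]_(r, n),
    Delta (cyc_interval i r) M = e * \det (\matrix_(a < r, b < r) (d b * M a (cyc i b))).
Proof.
move=> rn d1; have cI := card_cyc_interval i rn.
(* [t] sorts: the column listed at [b] is the one at cyclic position [t b]. *)
pose f (b : 'I_r) := enum_val (cast_ord (esym cI) b).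
have f_inj : injective f by move=> b c /enum_val_inj /cast_ord_inj.
have [s sE] : exists s : 'I_r -> 'I_r, forall b, cyc i (s b) = f b.
  apply: (@fin_all_exists _ (fun=> 'I_r) (fun b c => cyc i c = f b)) => b.
  have : f b \in cyc_interval i r by exact: enum_valP.
  by rewrite cyc_intervalE => /imsetP[c _ ->]; exists c.
have s_inj : injective s by move=> b c sbc; apply: f_inj; rewrite -!sE sbc.
pose t := perm s_inj.
exists ((\prod_b d b) * (-1) ^+ t).
  by rewrite exprMn sqrr_sign mulr1 -prodrXl big1.
move=> M; rewrite (DeltaE _ cI).
have -> : (\matrix_(a, b) M a (enum_val (cast_ord (esym cI) b))) =
    col_perm t (\matrix_(a, b) M a (cyc i b)).
  by apply/matrixP => a b; rewrite !mxE permE sE.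
have -> : (\matrix_(a, b) (d b * M a (cyc i b))) =
    (\matrix_(a, b) M a (cyc i b)) *m diag_mx (\row_b d b).
  by apply/matrixP => a b; rewrite mul_mx_diag !mxE mulrC.
rewrite col_permE !det_mulmx det_perm det_diag odd_permV.
under [X in _ = _ * (_ * X)]eq_bigr do rewrite mxE.
rewrite [RHS]mulrC -mulrA; congr (_ * _).
by rewrite mulrA -expr2 -prodrXl big1 ?mul1r.
Qed.

End CyclicMinors.

Lemma unit_det_neq0 (F : fieldType) p (M : 'M[F]_p) : (M \in unitmx) = (\det M != 0).
Proof. by rewrite unitmxE unitfE. Qed.

(** * Duality between columns and twisted columns *)

Section TwistColumns.
Variables (R : realType) (k l n : nat) (n0 : (0 < n)%N).
Implicit Types U : 'M[R]_(k + l, n).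

Definition first_row N : 'rV[R]_N := \row_b ((b : nat) == 0%N)%:R.

(** A kernel vector of the window would be a linear relation between the
    vectors of a basis. *)
Lemma generic_wdet U (j : int) : generic U -> wdet k U (j - l%:Z) != 0.
Proof.
move=> /(_ j) /andP[_]; set s := [seq _ | _ <- _] => fs.
pose X := [tuple ext_col k U (j - l%:Z + b%:Z) | b < k + l].
have sX : s = X :> seq _.
  by rewrite /s -val_enum_ord -map_comp /=; apply: eq_map.
rewrite sX in fs; move/freeP : fs => fs.
rewrite /wdet -det_tr; apply/det0P => -[v v0 vU]; case/negP: v0; apply/eqP/rowP => i.
rewrite mxE; apply: (fs (fun i => v 0 i)).
transitivity ((v *m (window k U (j - l%:Z) (k + l))^T)^T); last by rewrite vU trmx0.
rewrite trmx_mul trmxK; apply/colP => a; rewrite summxE mxE.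
by apply: eq_bigr => b _; rewrite -tnth_nth tnth_mktuple !mxE mulrC.
Qed.

Lemma dotpE N (x y : 'cV[R]_N) : dotp x y = (x^T *m y) 0 0.
Proof. by rewrite mxE; apply: eq_bigr => a _; rewrite mxE. Qed.

Lemma row_window_entry N (x : 'cV[R]_N) (U : 'M[R]_(N, n)) j r b :
  (x^T *m window k U j r) 0 b = dotp x (ext_col k U (j + b%:Z)).
Proof. by rewrite dotpE !mxE; apply: eq_bigr => a _; rewrite !mxE. Qed.

(** The duality equations that define a twisted column, as one matrix equation.
    When [k + l = 0] there is no such column, but then the equation is empty. *)
Lemma twist_colP U (j : int) : wdet k U (j - l%:Z) != 0 ->
  (twist_col U j)^T *m window k U (j - l%:Z) (k + l) = (-1) ^ j *: first_row (k + l).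
Proof.
move=> D0; apply/rowP => b.
have N0 : (0 < k + l)%N by apply: leq_ltn_trans (ltn_ord b).
rewrite row_window_entry !mxE.
pose S := [set u : 'cV[R]_(k + l) |
            dotp u (ext_col k U (j - l%:Z)) = (-1) ^ j /\
            (forall i : int, j - l%:Z + 1 <= i <= j + k%:Z - 1 ->
               dotp u (ext_col k U i) = 0)]%classic.
have [u Su] : (exists u, S u)%classic.
  pose u := ((-1) ^ j *: first_row (k + l) *m invmx (window k U (j - l%:Z) (k + l)))^T.
  have uE : u^T *m window k U (j - l%:Z) (k + l) = (-1) ^ j *: first_row (k + l).
    by rewrite trmxK -mulmxA mulVmx ?mulmx1// unit_det_neq0.
  exists u; split => [|i iP].
    have /rowP/(_ (Ordinal N0)) := uE; rewrite row_window_entry addr0 => ->.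
    by rewrite !mxE mulr1.
  have iN : (absz (i - (j - l%:Z))%R < k + l)%N by lia.
  have /rowP/(_ (Ordinal iN)) := uE; rewrite row_window_entry /=.
  have -> : j - l%:Z + (absz (i - (j - l%:Z))%R)%:Z = i by lia.
  by move=> ->; rewrite !mxE /= (_ : (_ == _) = false) ?mulr0//; apply/eqP; lia.
have [T1 T2] : S (twist_col U j) by exact: (xgetI 0 Su).
have [b0|b0] := eqVneq (b : nat) 0%N; first by rewrite b0 addr0 T1 mulr1.
by rewrite T2 ?mulr0//; have := ltn_ord b; lia.
Qed.

Lemma twist_col_uniq U (j : int) (z : 'cV[R]_(k + l)) : wdet k U (j - l%:Z) != 0 ->
  z^T *m window k U (j - l%:Z) (k + l) = (-1) ^ j *: first_row (k + l) ->
  twist_col U j = z.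
Proof.
move=> D0 zE; apply: trmx_inj.
have uW : window k U (j - l%:Z) (k + l) \in unitmx by rewrite unit_det_neq0.
by rewrite -(mulmxK uW (twist_col U j)^T) twist_colP// -zE mulmxK.
Qed.

Lemma twist_col_mulmx (g : 'M[R]_(k + l)) U (j : int) : g \in unitmx ->
  wdet k U (j - l%:Z) != 0 -> twist_col (g *m U) j = (invmx g)^T *m twist_col U j.
Proof.
move=> ug D0; apply: twist_col_uniq.
  by rewrite /wdet window_mulmx// det_mulmx mulf_neq0// -unit_det_neq0.
by rewrite trmx_mul trmxK window_mulmx// -mulmxA mulKmx// twist_colP.
Qed.

(** Equivariance of the twist; it makes [theta] independent of the bases
    chosen in the two subspaces. *)
Lemma twist_mulmx (g : 'M[R]_(k + l)) U : g \in unitmx ->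
  (forall j : int, wdet k U j != 0) -> twist (g *m U) = (invmx g)^T *m twist U.
Proof.
move=> ug D0; apply/matrixP => a c; rewrite mxE twist_col_mulmx// !mxE.
by apply: eq_bigr => b _; rewrite !mxE.
Qed.

(** Translation by a period changes the defining equations only by signs. *)
Lemma twist_colD U (j : int) : (forall j : int, wdet k U j != 0) ->
  twist_col U (j + n%:Z) = (-1) ^ (n%:Z - (k%:Z - 1)) *: twist_col U j.
Proof.
move=> D0; apply: twist_col_uniq => //.
have -> : window k U (j + n%:Z - l%:Z) (k + l) =
    (-1) ^ (k%:Z - 1) *: window k U (j - l%:Z) (k + l).
  apply/matrixP => a b; rewrite windowE [RHS]mxE windowE mulrA -col_signD//.
  have -> : j + n%:Z - l%:Z + b%:Z = j - l%:Z + b%:Z + n%:Z by lia.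
  by rewrite col_indexD.
rewrite -scalemxAr [(_ *: twist_col _ _)^T]linearZ /= -scalemxAl twist_colP// !scalerA.
have m1 : (-1 : R) != 0 by rewrite oppr_eq0 oner_eq0.
by rewrite -!expfzDr//; congr (_ ^ _ *: _); lia.
Qed.

Lemma dotp_twist0 U (j i : int) : (forall j : int, wdet k U j != 0) ->
  j - l%:Z < i < j + k%:Z -> dotp (twist_col U j) (ext_col k U i) = 0.
Proof.
move=> D0 ij; have iN : (absz (i - (j - l%:Z))%R < k + l)%N by lia.
have /rowP/(_ (Ordinal iN)) := twist_colP (D0 (j - l%:Z)).
rewrite row_window_entry /=.
have -> : j - l%:Z + (absz (i - (j - l%:Z))%R)%:Z = i by lia.
by move=> ->; rewrite !mxE /= (_ : (_ == _) = false) ?mulr0//; apply/eqP; lia.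
Qed.

Lemma dotp_twist1 U (j : int) : (0 < k + l)%N -> (forall j : int, wdet k U j != 0) ->
  dotp (twist_col U j) (ext_col k U (j - l%:Z)) = (-1) ^ j.
Proof.
move=> N0 D0; have /rowP/(_ (Ordinal N0)) := twist_colP (D0 (j - l%:Z)).
by rewrite row_window_entry addr0 => ->; rewrite !mxE mulr1.
Qed.

Definition twist_rows U (j : int) r : 'M[R]_(r, k + l) :=
  \matrix_(a, c) twist_col U (j + a%:Z) c 0.

Lemma twist_rows_window U (j : int) r (i : int) s a b :
  (twist_rows U j r *m window k U i s) a b =
  dotp (twist_col U (j + a%:Z)) (ext_col k U (i + b%:Z)).
Proof. by rewrite !mxE; apply: eq_bigr => c _; rewrite !mxE. Qed.

(** The Gram matrix is triangular, with signs on the diagonal. *)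
Lemma det_twist_rows_window U (j : int) r : (r <= k + l)%N -> (forall j : int, wdet k U j != 0) ->
  \det (twist_rows U j r *m window k U (j - l%:Z) r) = \prod_(a < r) (-1) ^ (j + a%:Z).
Proof.
move=> rN D0; rewrite det_trig; last first.
  apply/is_trig_mxP => a b ab; rewrite twist_rows_window dotp_twist0//.
  have := ltn_ord b; lia.
apply: eq_bigr => a _; rewrite twist_rows_window -(@dotp_twist1 U)//; last first.
  by apply: leq_trans rN; apply: leq_ltn_trans (ltn_ord a).
by congr (dotp _ (ext_col _ _ _)); lia.
Qed.

Lemma prod_sign_sqr r (j : int) : (\prod_(a < r) (-1 : R) ^ (j + a%:Z)) ^+ 2 = 1.
Proof. by rewrite -prodrXl big1// => a _; exact: sqr_sign. Qed.

Lemma det_twist_rows U (j : int) : (forall j : int, wdet k U j != 0) ->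
  \det (twist_rows U j (k + l)) * wdet k U (j - l%:Z) =
  \prod_(a < k + l) (-1) ^ (j + a%:Z).
Proof. by move=> D0; rewrite -det_mulmx det_twist_rows_window. Qed.

End TwistColumns.

(** * Cyclic minors of the twist *)

Section TwistMinorsTop.
Variables (R : realType) (k l n : nat) (n0 : (0 < n)%N).

Lemma window_cat N (U : 'M[R]_(N, n)) (j : int) p q :
  window k U j (p + q) = row_mx (window k U j p) (window k U (j + p%:Z) q).
Proof.
apply/matrixP => a b; rewrite windowE//.
case: (split_ordP b) => c ->; rewrite ?(row_mxEl, row_mxEr) windowE//=.
by have -> : j + (p + c)%N%:Z = j + p%:Z + c%:Z by lia.
Qed.

Lemma det_row_mxC : exists2 e : R, e ^+ 2 = 1 &
  forall (A : 'M[R]_(k + l, k)) (B : 'M[R]_(k + l, l)),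
    \det (row_mx A B) = e * \det (castmx (erefl, addnC l k) (row_mx B A)).
Proof.
pose s (x : 'I_(k + l)) : 'I_(k + l) := cast_ord (addnC l k)
  match fintype.split x with inl i => rshift l i | inr i => lshift k i end.
have s_inj : injective s.
  move=> x y /cast_ord_inj; rewrite /s.
  case: (split_ordP x) => i ->; case: (split_ordP y) => i' -> //.
  - by move/rshift_inj => ->.
  - by move/eqP; rewrite eq_rlshift.
  - by move/eqP; rewrite eq_lrshift.
  - by move/lshift_inj => ->.
exists ((-1) ^+ perm s_inj); first by rewrite sqrr_sign.
move=> A B.
have -> : row_mx A B = col_perm (perm s_inj) (castmx (erefl, addnC l k) (row_mx B A)).
  apply/matrixP => a b; rewrite [RHS]mxE permE castmxE /s cast_ordK /= cast_ord_id.
  by case: (split_ordP b) => c ->; rewrite ?(row_mxEl, row_mxEr).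
by rewrite col_permE det_mulmx det_perm odd_permV mulrC.
Qed.

Variables (V : 'M[R]_(k, n)) (W : 'M[R]_(l, n)).
Let U := col_mx V W.
Hypothesis D0 : forall j : int, wdet k U j != 0.

(** Completing the twisted columns [y_j, ..., y_(j+k-1)] by the last [l]
    standard rows gives a matrix [Q] whose determinant is the minor on the left.
    The product of [Q] with the window of determinant [D_j] is block triangular,
    since these twisted columns are orthogonal to the last [l] columns of the
    window; its diagonal blocks are a triangular Gram matrix and a window of
    [W]. *)
Lemma twist_minor_top (j : int) :
  \det (lsubmx (twist_rows U j k)) * wdet k U (j - l%:Z) =
  (\prod_(a < k) (-1) ^ (j + a%:Z)) * wdet k W (j - l%:Z + k%:Z).
Proof.
set P := twist_rows U j k; set r := \prod_(a < k) _.
have <- : \det (col_mx P (row_mx 0 1%:M)) = \det (lsubmx P).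
  by rewrite -{1}[P]hsubmxK -/(block_mx _ _ _ _) det_ublock det1 mulr1.
rewrite -det_mulmx mul_col_mx window_cat// mul_mx_row.
rewrite [P *m window k U (j - _ + _) _](_ : _ = 0); last first.
  apply/matrixP => a b; rewrite twist_rows_window// [RHS]mxE dotp_twist0//.
  have := ltn_ord a; have := ltn_ord b; lia.
rewrite !window_col_mx// mul_mx_row !mul_row_col !mul0mx !mul1mx !add0r.
rewrite -/(block_mx _ _ _ _) det_lblock -window_col_mx// det_twist_rows_window//.
exact: leq_addr.
Qed.

End TwistMinorsTop.

Section TwistMinorsBottom.
Variables (R : realType) (k l n : nat) (n0 : (0 < n)%N).

(** The same argument with the first [k] standard rows: the twisted columns
    [y_j, ..., y_(j+l-1)] are orthogonal to the last [k] columns of the window.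
    These columns have to be moved to the front to make the product block
    triangular, whence a sign. *)
Lemma twist_minor_bot (j : int) : exists2 e : R, e ^+ 2 = 1 &
  forall (V : 'M[R]_(k, n)) (W : 'M[R]_(l, n)), let U := col_mx V W in
  (forall j : int, wdet k U j != 0) ->
  \det (rsubmx (twist_rows U j l)) * wdet k U (j - l%:Z) = e * wdet k V j.
Proof.
have [e e1 eP] := det_row_mxC R k l.
exists (e * (\prod_(a < l) (-1) ^ (j + a%:Z))).
  by rewrite exprMn e1 prod_sign_sqr mulr1.
move=> V W U D0; set P := twist_rows U j l.
have <- : \det (col_mx (row_mx 1%:M 0) P) = \det (rsubmx P).
  by rewrite -{1}[P]hsubmxK -/(block_mx _ _ _ _) det_lblock det1 mul1r.
have -> : wdet k U (j - l%:Z) = e * \det (row_mx (window k U j k) (window k U (j - l%:Z) l)).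
  rewrite eP mulrA -expr2 e1 mul1r; congr (\det _).
  rewrite -[in window k U j k](subrK l%:Z j) -window_cat//.
  apply/matrixP => a b; rewrite castmxE windowE//= windowE//=.
  by rewrite cast_ord_id.
rewrite mulrCA -det_mulmx -mulrA; congr (_ * _).
rewrite mul_col_mx !mul_mx_row.
rewrite [P *m window k U j _](_ : _ = 0); last first.
  apply/matrixP => a b; rewrite twist_rows_window// [RHS]mxE dotp_twist0//.
  have := ltn_ord a; have := ltn_ord b; lia.
rewrite !window_col_mx// !mul_row_col !mul0mx !mul1mx !addr0.
rewrite -/(block_mx _ _ _ _) det_ublock -window_col_mx// det_twist_rows_window//.
  exact: mulrC.
exact: leq_addl.
Qed.

End TwistMinorsBottom.

(** * The differential of the twist *)

Section TwistDifferential.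
Variables (R : realType) (k l n : nat) (n0 : (0 < n)%N).
Implicit Types U X : 'M[R]_(k + l, n).

Let d : R := (-1) ^ (n%:Z - (k%:Z - 1)).

Lemma twist_colDz U (j q : int) : (forall j : int, wdet k U j != 0) ->
  twist_col U (j + q * n%:Z) = d ^+ `|q| *: twist_col U j.
Proof.
move=> D0.
by apply: antiperiodicZ => [|i]; [exact: sqr_sign|exact: twist_colD].
Qed.

Lemma mx_linear_entry p q (a : R) (A B : 'M[R]_(p, q)) i j :
  (a *: A + B) i j = a * A i j + B i j.
Proof. by rewrite !mxE. Qed.

(** The solution of the linearised duality equations: column [c] pairs with the
    window of [U] to minus the pairing of the twisted column with the window
    of [X]. *)
Definition dtwist U X : 'M[R]_(k + l, n) :=
  \matrix_(a, c) (- ((twist_col U c.+1%:Z)^T *m window k X (c.+1%:Z - l%:Z) (k + l)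
                   *m invmx (window k U (c.+1%:Z - l%:Z) (k + l)))) 0 a.

Lemma dtwist_uniq U X (Z : 'M[R]_(k + l, n)) : (forall j : int, wdet k U j != 0) ->
  (forall c : 'I_n, (col c Z)^T *m window k U (c.+1%:Z - l%:Z) (k + l) =
     - ((twist_col U c.+1%:Z)^T *m window k X (c.+1%:Z - l%:Z) (k + l))) ->
  dtwist U X = Z.
Proof.
move=> D0 ZP; apply/matrixP => a c; rewrite mxE -mulNmx -ZP mulmxK ?mxE//.
by rewrite unit_det_neq0; exact: D0.
Qed.

Lemma window_linear N (j : int) r : linear (fun X : 'M[R]_(N, n) => window k X j r).
Proof.
move=> a x y; apply/matrixP => i b.
by rewrite mx_linear_entry !windowE// mx_linear_entry mulrDr mulrCA.
Qed.

Lemma dtwist_linear U : linear (dtwist U).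
Proof.
move=> a x y; apply/matrixP => i c; rewrite mx_linear_entry.
rewrite [LHS]mxE [dtwist U x i c]mxE [dtwist U y i c]mxE -mx_linear_entry; congr (_ _ 0 i).
by rewrite window_linear mulmxDr mulmxDl -scalemxAr -scalemxAl opprD -scalerN.
Qed.

Let source (ct : 'I_n * 'I_(k + l)) : 'I_n * 'I_(k + l) :=
  (col_index n0 (ct.1.+1%:Z - l%:Z + ct.2%:Z), rev_ord ct.2).

Let source_inj : injective source.
Proof.
move=> [c t] [c' t'] e.
have /= /rev_ord_inj e2 := congr1 snd e; rewrite -{t'}e2 in e *.
have /= cc := congr1 (fun x => val x.1) e.
congr pair; apply: val_inj => /=.
rewrite -(modn_small (ltn_ord c)) -(modn_small (ltn_ord c')).
have : (c.+1%:Z - l%:Z + t%:Z - 1 = c'.+1%:Z - l%:Z + t%:Z - 1 %[mod n%:Z])%Z.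
  have nz : n%:Z != 0 by lia.
  by apply/eqP; have := modz_ge0 (c.+1%:Z - l%:Z + t%:Z - 1) nz;
     have := modz_ge0 (c'.+1%:Z - l%:Z + t%:Z - 1) nz; lia.
have -> : c.+1%:Z - l%:Z + t%:Z - 1 = c%:Z + (t%:Z - l%:Z) by lia.
have -> : c'.+1%:Z - l%:Z + t%:Z - 1 = c'%:Z + (t%:Z - l%:Z) by lia.
by move/eqP; rewrite eqz_modDr !modz_nat eqz_nat => /eqP.
Qed.

Let sign (c : 'I_n) (t : 'I_(k + l)) : R :=
  - (col_sign R k n (c.+1%:Z - l%:Z + t%:Z) *
     d ^+ absz ((c.+1%:Z - l%:Z + t%:Z - 1) %/ n%:Z)%Z).

(** The pairing of the twisted column [y_j] with [X(i)] can be filed under [j]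
    or under [i]. Computing it under [i] is a multiplication of column [i] of
    [X] by the matrix of the twisted columns seeing [i]; inverting the window is
    a multiplication in column [j]. The permutation [source] passes from one
    filing to the other, and [sign] collects the period signs. *)
Lemma dtwistE U X : (forall j : int, wdet k U j != 0) ->
  dtwist U X = (rowwise (fun c : 'I_n => invmx (window k U (c.+1%:Z - l%:Z) (k + l)))
    (sign_entries sign (perm_entries source
      (rowwise (fun i : 'I_n => (twist_rows U (i%:Z + 2 - k%:Z) (k + l))^T) X^T))))^T.
Proof.
move=> D0; apply/matrixP => a c; rewrite mxE -mulNmx [RHS]mxE.
rewrite [RHS]mxE -[LHS]/((_ *m invmx _) 0 a) /rowwise.
congr ((_ *m _) 0 a); apply/rowP => t.
rewrite [LHS]mxE row_window_entry [RHS]mxE [RHS]mxE [X in _ = _ * X]mxE.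
rewrite [X in _ = _ * X]mxE mulNr; congr (- _).
rewrite ext_colE /= -mulrA.
set J := c.+1%:Z - l%:Z + t%:Z; set i := col_index n0 J.
have dotpZ (s : R) (u v : 'cV[R]_(k + l)) : dotp u (s *: v) = s * dotp u v.
  by rewrite /dotp mulr_sumr; apply: eq_bigr => b _; rewrite mxE mulrCA.
rewrite dotpZ; congr (_ * _).
(* The column [J] is [i + 1] up to a multiple of the period, and [rev_ord t]
   is the place of [c] among the twisted columns that see [i]. *)
have -> : c.+1%:Z = (absz ((J - 1) %% n%:Z)%Z)%:Z + 2 - k%:Z + (rev_ord t)%:Z
    + ((J - 1) %/ n%:Z)%Z * n%:Z.
  have nz : n%:Z != 0 by lia.
  have := divz_eq (J - 1) n%:Z; have := modz_ge0 (J - 1) nz.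
  by have := ltn_ord t; rewrite /J /=; lia.
rewrite twist_colDz//.
rewrite /dotp [in RHS]mxE mulr_sumr; apply: eq_bigr => b _.
by rewrite !mxE -mulrA; congr (_ * _); rewrite mulrC.
Qed.

(** The two families of column multiplications contribute the inverses of the
    determinants of all the windows of [U], once each: directly for the second
    family, and through [det_twist_rows] for the first. *)
Lemma detl_dtwist : exists2 e : R, e ^+ 2 = 1 & forall U,
  (forall j : int, wdet k U j != 0) -> detl (dtwist U) = e * (wprod k U ^+ 2)^-1.
Proof.
pose d0 : R := ((-1) ^ (k%:Z - 1)) ^+ (k + l).
have d01 : d0 ^+ 2 = 1 by rewrite exprAC sqr_sign expr1n.
have [e1 e1s e1P] := prod_shift (1 - l%:Z) n0 d01.
have [e2 e2s e2P] := prod_shift (2 - k%:Z - l%:Z) n0 d01.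
pose e3 : R := \prod_(i < n) \prod_(a < k + l) (-1) ^ (i%:Z + 2 - k%:Z + a%:Z).
have e3s : e3 ^+ 2 = 1 by rewrite -prodrXl big1// => i _; exact: prod_sign_sqr.
pose e4 := detl (sign_entries sign) * detl (@perm_entries R _ _ source).
have e4s : e4 ^+ 2 = 1.
  rewrite exprMn detl_perm_entries// detl_sign_entries ?mulr1// => c t.
  by rewrite sqrrN exprMn col_sign_sqr exprAC sqr_sign expr1n mulr1.
exists (e1 * e2 * e3 * e4); first by rewrite 3!exprMn e1s e2s e3s e4s !mulr1.
move=> U D0.
have wD (j : int) : wdet k U (j + n%:Z) = d0 * wdet k U j by rewrite wdetD.
rewrite (eq_detl (fun X => dtwistE X D0)).
set B1 := (fun c : 'I_n => invmx _); set B2 := (fun i : 'I_n => _^T).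
have l1 := rowwise_linear B1; have l2 := rowwise_linear B2.
have ls := @sign_entries_linear _ _ _ sign.
have lp := @perm_entries_linear R _ _ source.
pose f := rowwise B1 \o (sign_entries sign \o (perm_entries source \o rowwise B2)).
rewrite (detl_trmx_conj (f := f)); last first.
  by move=> a x y; rewrite /f /= l2 lp ls l1.
rewrite !detl_comp// !detl_rowwise.
have -> : \prod_i \det (B1 i) = (e1 * wprod k U)^-1.
  rewrite /wprod -e1P// -prodfV; apply: eq_bigr => i _; rewrite det_inv.
  by congr (\det (window _ _ _ _))^-1; lia.
have -> : \prod_i \det (B2 i) = e3 * (e2 * wprod k U)^-1.
  rewrite /wprod -e2P// -prodfV -big_split; apply: eq_bigr => i _.
  rewrite det_tr /= -(det_twist_rows n0 _ D0).
  have -> : i%:Z + 2 - k%:Z - l%:Z = i%:Z + (2 - k%:Z - l%:Z) by lia.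
  by rewrite mulfK.
have inv (e : R) : e ^+ 2 = 1 -> e^-1 = e.
  by rewrite expr2 => /mulr1_eq.
rewrite expr2 !invfM (inv _ e1s) (inv _ e2s) /e4.
ring.
Qed.
End TwistDifferential.

(** * Products of cyclic minors *)

Section CyclicProducts.
Variables (R : realType) (k l n : nat) (n0 : (0 < n)%N).

Lemma cyc_quotient (i : 'I_n) (b : nat) :
  i%:Z + 1 + b%:Z = ((i + b) %% n)%N.+1%:Z + ((i + b) %/ n)%N%:Z * n%:Z.
Proof. by have := divn_eq (i + b) n; lia. Qed.

Lemma col_index_cyc (i : 'I_n) (b : nat) :
  col_index n0 (i%:Z + 1 + b%:Z) = cyc i b.
Proof.
apply: val_inj; rewrite /= (_ : i%:Z + 1 + b%:Z - 1 = (i + b)%N%:Z); last by lia.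
by rewrite modz_nat.
Qed.

Lemma wprod_shift r (a : int) :
  eqpm (fun=> True) (fun M : 'M[R]_(r, n) => \prod_(i < n) wdet k M (i%:Z + a))
    (wprod k (r := r)).
Proof.
have d1 : (((-1) ^ (k%:Z - 1)) ^+ r : R) ^+ 2 = 1.
  by rewrite exprAC sqr_sign expr1n.
have [e es eP] := prod_shift a n0 d1.
by exists e => // M _; apply: (eP (wdet k M)) => j; exact: wdetD.
Qed.

Lemma prod_Delta_cyc r : (r <= n)%N ->
  eqpm (fun=> True) (fun M : 'M[R]_(r, n) => \prod_(i < n) Delta (cyc_interval i r) M)
    (wprod k (r := r)).
Proof.
move=> rn; apply: eqpm_trans (wprod_shift _ 1); apply: eqpm_prod => i.
have [e es eP] := Delta_cyc i rn (fun b => col_sign_sqr R k n (i%:Z + 1 + b%:Z)).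
exists e => // M _; rewrite eP; congr (_ * \det _).
by apply/matrixP => a b; rewrite windowE// mxE col_index_cyc.
Qed.

Lemma cyc_prod_wprod r (A : 'M[R]_(r, n - r)) : (r <= n)%N ->
  (cyc_prod A != 0) = (wprod k (std_mx A) != 0).
Proof.
move=> rn; have [e e1 eP] := prod_Delta_cyc rn.
by rewrite /cyc_prod eP// mulf_eq0 negb_or (sign_neq0 e1).
Qed.

Lemma twist_col_cyc (U : 'M[R]_(k + l, n)) (i : 'I_n) (b : nat) a :
  (forall j : int, wdet k U j != 0) ->
  twist_col U (i%:Z + 1 + b%:Z) a 0 =
  ((-1) ^ (n%:Z - (k%:Z - 1))) ^+ ((i + b) %/ n) * twist U a (cyc i b).
Proof. by move=> D0; rewrite cyc_quotient twist_colDz// !mxE. Qed.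

Let T : Type := ('M[R]_(k, n) * 'M[R]_(l, n))%type.
Let U (x : T) := col_mx x.1 x.2.
Let P (x : T) := forall j : int, wdet k (U x) j != 0.
Let d r (i : 'I_n) (b : 'I_r) : R := ((-1) ^ (n%:Z - (k%:Z - 1))) ^+ ((i + b) %/ n).
Let ds r i b : @d r i b ^+ 2 = 1.
Proof. by rewrite exprAC sqr_sign expr1n. Qed.

Let shiftP r (h : T -> 'M[R]_(r, n)) (a : int) :
  eqpm P (fun x => wprod k (h x)) (fun x => \prod_(i < n) wdet k (h x) (i%:Z + a)).
Proof. by apply: eqpm_sym; apply: (eqpm_comp (h := h) _ (wprod_shift r a)). Qed.

(** Product of [twist_minor_top] over a period; the windows of [W] are those of
    a shifted period, which only costs a sign. *)
Lemma prod_Delta_twist_top : (k <= n)%N ->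
  eqpm P (fun x => (\prod_(i < n) Delta (cyc_interval i k) (usubmx (twist (U x))))
                    * wprod k (U x))
         (fun x => wprod k x.2).
Proof.
move=> kn; apply: eqpm_trans (eqpm_sym (shiftP (fun x => x.2) (1 - l%:Z + k%:Z))).
apply: eqpm_trans (eqpm_mul (eqpm_refl P _) (shiftP U (1 - l%:Z))) _.
apply: eqpm_trans (eqpm_eq (fun x _ => esym (big_split _ _ _ _ _))) _.
apply: eqpm_prod => i; have [e es eP] := Delta_cyc i kn (@ds k i).
exists (e * \prod_(a < k) (-1) ^ (i%:Z + 1 + a%:Z)).
  by rewrite exprMn es prod_sign_sqr mulr1.
move=> x Px; rewrite /U /= eP -!mulrA; congr (_ * _).
have := twist_minor_top n0 Px (i%:Z + 1).
have -> : i%:Z + 1 - l%:Z + k%:Z = i%:Z + (1 - l%:Z + k%:Z) by lia.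
have -> : i%:Z + 1 - l%:Z = i%:Z + (1 - l%:Z) by lia.
move=> <-; congr (_ * _); rewrite -det_tr; congr (\det _).
apply/matrixP => a b; rewrite 6!mxE twist_col_cyc//.
by rewrite [twist _ _ _]mxE.
Qed.

Lemma prod_Delta_twist_bot : (l <= n)%N ->
  eqpm P (fun x => (\prod_(i < n) Delta (cyc_interval i l) (dsubmx (twist (U x))))
                    * wprod k (U x))
         (fun x => wprod k x.1).
Proof.
move=> ln; apply: eqpm_trans (eqpm_sym (shiftP (fun x => x.1) 1)).
apply: eqpm_trans (eqpm_mul (eqpm_refl P _) (shiftP U (1 - l%:Z))) _.
apply: eqpm_trans (eqpm_eq (fun x _ => esym (big_split _ _ _ _ _))) _.
apply: eqpm_prod => i; have [e es eP] := Delta_cyc i ln (@ds l i).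
have [e' e's e'P] := twist_minor_bot R k l n0 (i%:Z + 1).
exists (e * e'); first by rewrite exprMn es e's mulr1.
move=> x Px; rewrite /U /= eP -!mulrA; congr (_ * _).
have := e'P x.1 x.2 Px.
have -> : i%:Z + 1 - l%:Z = i%:Z + (1 - l%:Z) by lia.
move=> <-; congr (_ * _); rewrite -det_tr; congr (\det _).
apply/matrixP => a b; rewrite 6!mxE twist_col_cyc//.
by rewrite [twist _ _ _]mxE.
Qed.

End CyclicProducts.

(** * Row spans and charts *)

Lemma rowspanP (R : realType) (r n : nat) (M : 'M[R]_(r, n)) (x : 'rV[R]_n) :
  (x \in rowspan M) <-> (exists c : 'rV[R]_r, x = c *m M).
Proof.
rewrite /rowspan span_def big_image /=; split=> [/memv_sumP[v vM ->]|[c ->]].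
  have [c cE] : exists c : 'I_r -> R, forall i, v i = c i *: row i M.
    apply: (@fin_all_exists _ (fun=> R) (fun i s => v i = s *: row i M)) => i.
    by have /vlineP[s ->] := vM i isT; exists s.
  exists (\row_i c i); rewrite mulmx_sum_row.
  by apply: eq_bigr => i _; rewrite cE mxE.
rewrite mulmx_sum_row; apply: memv_sumr => i _.
by apply: memvZ; exact: memv_line.
Qed.

Lemma rowspan_mulmx (R : realType) (r n : nat) (g : 'M[R]_r) (M : 'M[R]_(r, n)) :
  g \in unitmx -> rowspan (g *m M) = rowspan M.
Proof.
move=> ug; apply/vspaceP => x; apply/idP/idP => /rowspanP[c ->]; apply/rowspanP.
  by exists (c *m g); rewrite mulmxA.
by exists (c *m invmx g); rewrite mulmxA mulmxKV.
Qed.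

Lemma eq_rowspan (R : realType) (r n : nat) (M N : 'M[R]_(r, n)) :
  rowspan M = rowspan N -> exists g : 'M[R]_r, M = g *m N.
Proof.
move=> MN.
have [f fE] : exists f : 'I_r -> 'rV[R]_r, forall i, row i M = f i *m N.
  apply: (@fin_all_exists _ (fun=> 'rV[R]_r) (fun i s => row i M = s *m N)) => i.
  apply/rowspanP; rewrite -MN; apply/rowspanP.
  by exists (delta_mx 0 i); rewrite rowE.
exists (\matrix_i f i); apply/row_matrixP => i.
by rewrite fE row_mul rowK.
Qed.

(** A right inverse [L] is the form in which full rank is used: it makes the
    change of basis from [M] to the chosen basis of its row span invertible. *)
Lemma gr_mx_rowspan (R : realType) (r n : nat) (M : 'M[R]_(r, n))
    (L : 'M[R]_(n, r)) : M *m L = 1%:M ->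
  exists2 g : 'M[R]_r, g \in unitmx & gr_mx r (rowspan M) = g *m M.
Proof.
move=> ML; set X := rowspan M.
have dX : (\dim X <= r)%N.
  by apply: leq_trans (dim_span _) _; rewrite size_image card_ord.
have XE : X = rowspan (gr_mx r X).
  apply/vspaceP => x; apply/idP/idP => [xX|].
    have := coord_vbasis xX => ->; apply: memv_suml => i _; apply: memvZ.
    apply/rowspanP; exists (delta_mx 0 (widen_ord dX i)).
    by rewrite -rowE; apply/rowP => j; rewrite !mxE.
  move=> /rowspanP[c ->]; rewrite mulmx_sum_row; apply: memv_suml => i _.
  apply: memvZ; rewrite rowK.
  have [iX|Xi] := ltnP i (\dim X); last by rewrite nth_default ?mem0v// size_tuple.
  by apply: vbasis_mem; rewrite mem_nth// size_tuple.
have [g gE] := eq_rowspan (esym XE).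
have [h hE] := eq_rowspan XE.
exists g => //.
have /mulmx1_unit[//] : h *m g = 1%:M.
by rewrite -ML [in RHS]hE gE -!mulmxA ML mulmx1.
Qed.

Section Charts.
Variables (R : realType) (r n : nat) (rn : (r <= n)%N).

Definition pivot (j : 'I_r) : 'I_n := cast_ord (subnKC rn) (lshift (n - r) j).
Definition nonpivot (j : 'I_(n - r)) : 'I_n := cast_ord (subnKC rn) (rshift r j).

(** The two blocks of columns that the chart distinguishes; [pivots M] is the
    factor to divide by in order to bring [M] to the form of the chart. *)
Definition pivots q (M : 'M[R]_(q, n)) : 'M[R]_(q, r) := mxsub id pivot M.
Definition nonpivots q (M : 'M[R]_(q, n)) : 'M[R]_(q, n - r) := mxsub id nonpivot M.
Definition join_pivots q (G : 'M[R]_(q, r)) (H : 'M[R]_(q, n - r)) : 'M[R]_(q, n) :=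
  castmx (erefl, subnKC rn) (row_mx G H).

Lemma join_pivotsK q (G : 'M[R]_(q, r)) H : pivots (join_pivots G H) = G.
Proof.
by apply/matrixP => i j; rewrite mxE castmxE cast_ordK cast_ord_id row_mxEl.
Qed.

Lemma join_nonpivotsK q (G : 'M[R]_(q, r)) H : nonpivots (join_pivots G H) = H.
Proof.
by apply/matrixP => i j; rewrite mxE castmxE cast_ordK cast_ord_id row_mxEr.
Qed.

Lemma pivotsP q (M N : 'M[R]_(q, n)) :
  pivots M = pivots N -> nonpivots M = nonpivots N -> M = N.
Proof.
move=> /matrixP e1 /matrixP e2; apply/matrixP => i j.
rewrite -(cast_ordKV (subnKC rn) j); set c := cast_ord _ j.
case: (split_ordP c) => c' ->.
  by have := e1 i c'; rewrite !mxE.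
by have := e2 i c'; rewrite !mxE.
Qed.

Lemma pivots_mulmx p q (g : 'M[R]_(p, q)) M : pivots (g *m M) = g *m pivots M.
Proof. by apply/matrixP => i j; rewrite !mxE; apply: eq_bigr => s _; rewrite !mxE. Qed.

Lemma nonpivots_mulmx p q (g : 'M[R]_(p, q)) M : nonpivots (g *m M) = g *m nonpivots M.
Proof. by apply/matrixP => i j; rewrite !mxE; apply: eq_bigr => s _; rewrite !mxE. Qed.

Lemma join_pivots_mulmx p q (g : 'M[R]_(p, q)) G H :
  g *m join_pivots G H = join_pivots (g *m G) (g *m H).
Proof.
by apply: pivotsP; rewrite ?pivots_mulmx ?nonpivots_mulmx ?join_pivotsK ?join_nonpivotsK.
Qed.

Lemma std_mxE (A : 'M[R]_(r, n - r)) : std_mx A = join_pivots 1%:M A.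
Proof.
rewrite /std_mx /join_pivots; move: (subnKC rn) (row_mx _ _) => /=.
move: (n - r)%N (0 : 'M[R]_(r, n)) => q Z e B; case: _ / e Z => Z.
by rewrite conform_mx_id castmx_id.
Qed.

Lemma pivots_std A : pivots (std_mx A) = 1%:M.
Proof. by rewrite std_mxE join_pivotsK. Qed.

Lemma nonpivots_std A : nonpivots (std_mx A) = A.
Proof. by rewrite std_mxE join_nonpivotsK. Qed.

Lemma std_mx_rinv (A : 'M[R]_(r, n - r)) : exists L : 'M[R]_(n, r), std_mx A *m L = 1%:M.
Proof.
exists (pivots 1%:M); by rewrite -pivots_mulmx mulmx1 pivots_std.
Qed.

Lemma pivots_factor (M : 'M[R]_(r, n)) : pivots M \in unitmx ->
  M = pivots M *m std_mx (invmx (pivots M) *m nonpivots M).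
Proof.
move=> uM; apply: pivotsP; rewrite ?pivots_mulmx ?nonpivots_mulmx.
  by rewrite pivots_std mulmx1.
by rewrite nonpivots_std mulmxA mulmxV// mul1mx.
Qed.

Lemma chart_inj : injective (@chart R r n).
Proof.
move=> A B /eq_rowspan[g AB].
have g1 : g = 1%:M.
  by have := congr1 (@pivots _) AB; rewrite pivots_mulmx !pivots_std mulmx1.
by have := congr1 (@nonpivots _) AB; rewrite g1 mul1mx !nonpivots_std.
Qed.

Lemma chart_coord_rowspan (M : 'M[R]_(r, n)) : pivots M \in unitmx ->
  chart_coord r (rowspan M) = invmx (pivots M) *m nonpivots M.
Proof.
move=> uM; set A := _ *m _; have MA : chart A = rowspan M.
  by rewrite [in RHS](pivots_factor uM) rowspan_mulmx.
by apply: chart_inj; rewrite MA; 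
exact: (@xgetI _ 0 [set B : 'M[R]_(r, n - r) | chart B = rowspan M]%classic _ MA).
Qed.

Lemma gr_mx_chart (A : 'M[R]_(r, n - r)) :
  exists2 g : 'M[R]_r, g \in unitmx & gr_mx r (chart A) = g *m std_mx A.
Proof. by have [L] := std_mx_rinv A; exact: gr_mx_rowspan. Qed.

Lemma Delta_mulmx (I : {set 'I_n}) (g : 'M[R]_r) (M : 'M[R]_(r, n)) : #|I| = r ->
  Delta I (g *m M) = \det g * Delta I M.
Proof.
move=> Ir; rewrite !(DeltaE _ Ir) -det_mulmx; congr (\det _).
by apply/matrixP => i j; rewrite !mxE; apply: eq_bigr => s _; rewrite mxE.
Qed.

Lemma prod_Delta_factor (M : 'M[R]_(r, n)) : pivots M \in unitmx ->
  \prod_(i < n) Delta (cyc_interval i r) M =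
  \det (pivots M) ^+ n * cyc_prod (invmx (pivots M) *m nonpivots M).
Proof.
move=> uM; rewrite [in LHS](pivots_factor uM) /cyc_prod.
rewrite -[n in _ ^+ n]card_ord -prodr_const -big_split; apply: eq_bigr => i _.
by rewrite Delta_mulmx// card_cyc_interval.
Qed.

End Charts.

(** * The stacked twist map in charts *)

Section ThetaCoord.
Variables (R : realType) (k l n : nat) (n0 : (0 < n)%N).
Hypotheses (kn : (k <= n)%N) (ln : (l <= n)%N).

Local Notation E0 := ('M[R]_(k, n - k) * 'M[R]_(l, n - l))%type.
Implicit Type x : E0.

Definition stack_std x : 'M[R]_(k + l, n) := col_mx (std_mx x.1) (std_mx x.2).

(** The open condition under which the chart expression of [theta] is the
    rational map computed below; besides the twist being defined, the cyclic
    minors of both factors must not vanish, so that the image is again in the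
    domain of the chart. *)
Definition regular x : Prop :=
  [/\ forall j : int, wdet k (stack_std x) j != 0,
      forall j : int, wdet k (std_mx x.1) j != 0 &
      forall j : int, wdet k (std_mx x.2) j != 0].

Lemma stack_chart2 x : exists g1 : 'M[R]_k, exists g2 : 'M[R]_l,
  [/\ g1 \in unitmx, g2 \in unitmx &
      stack k l (chart2 x) = block_mx g1 0 0 g2 *m stack_std x].
Proof.
have [g1 u1 e1] := gr_mx_chart kn x.1; have [g2 u2 e2] := gr_mx_chart ln x.2.
exists g1, g2; split => //.
by rewrite /stack /= e1 e2 mul_block_col !mul0mx addr0 add0r.
Qed.

Lemma wdet_mulmx r (g : 'M[R]_r) (M : 'M[R]_(r, n)) (j : int) :
  wdet k (g *m M) j = \det g * wdet k M j.
Proof. by rewrite /wdet window_mulmx// det_mulmx. Qed.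

Lemma regular_theta_dom x : theta_dom k l (chart2 x) ->
  cyc_prod x.1 != 0 -> cyc_prod x.2 != 0 -> regular x.
Proof.
move=> [_ _ gx] c1 c2; split.
- move=> j; have := generic_wdet (j + l%:Z) gx; rewrite addrK.
  have [g1 [g2 [_ _ ->]]] := stack_chart2 x.
  by rewrite wdet_mulmx mulf_eq0 negb_or => /andP[].
- by apply/(wprod_neq0P k n0); rewrite -(cyc_prod_wprod k n0).
- by apply/(wprod_neq0P k n0); rewrite -(cyc_prod_wprod k n0).
Qed.

Definition twist_top x := usubmx (twist (stack_std x)).
Definition twist_bot x := dsubmx (twist (stack_std x)).

(** The pivot block is the transpose of a cyclic minor of the twist, whose value
    is given by [twist_minor_top]. *)
Lemma pivots_twist_top_unit x : regular x -> pivots kn (twist_top x) \in unitmx.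
Proof.
move=> [D0 _ W0]; rewrite unit_det_neq0 -det_tr.
have -> : (pivots kn (twist_top x))^T = lsubmx (twist_rows (stack_std x) 1 k).
  by apply/matrixP => a b; rewrite !mxE; congr (twist_col _ _ _ _).
have := twist_minor_top n0 D0 1.
move=> e; apply: contraTneq isT => d0; move/eqP: e.
rewrite d0 mul0r eq_sym mulf_eq0 (negbTE (W0 _)) orbF.
by rewrite (negbTE (sign_neq0 (prod_sign_sqr R k 1))).
Qed.

Lemma pivots_twist_bot_unit x : regular x -> pivots ln (twist_bot x) \in unitmx.
Proof.
move=> [D0 V0 _]; rewrite unit_det_neq0 -det_tr.
have -> : (pivots ln (twist_bot x))^T = rsubmx (twist_rows (stack_std x) 1 l).
  by apply/matrixP => a b; rewrite !mxE; congr (twist_col _ _ _ _).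
have [e e1 /(_ _ _ D0) eP] := twist_minor_bot R k l n0 1.
apply: contraTneq isT => d0; move/eqP: eP.
by rewrite d0 mul0r eq_sym mulf_eq0 (negbTE (V0 _)) orbF (negbTE (sign_neq0 e1)).
Qed.

(** By equivariance the arbitrary bases of the subspaces change the rows of the
    two blocks of the twist only within their spans, so that row reduction of
    the twist of [stack_std x] gives the chart coordinates. *)
Lemma theta_coordE x : regular x ->
  theta_coord x =
  (invmx (pivots kn (twist_top x)) *m nonpivots kn (twist_top x),
   invmx (pivots ln (twist_bot x)) *m nonpivots ln (twist_bot x)).
Proof.
move=> rx; have [D0 _ _] := rx.
rewrite /theta_coord /theta.
have [g1 [g2 [u1 u2 ->]]] := stack_chart2 x.
have ug : block_mx g1 0 0 g2 \in unitmx.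
  by rewrite unit_det_neq0 det_ublock mulf_neq0// -unit_det_neq0.
rewrite twist_mulmx// invmx_block_diag// tr_block_mx !trmx0.
rewrite -[twist (stack_std x)]vsubmxK mul_block_col !mul0mx addr0 add0r.
rewrite col_mxKu col_mxKd /= !rowspan_mulmx ?unitmx_tr ?unitmx_inv//.
congr pair; apply: chart_coord_rowspan.
  exact: pivots_twist_top_unit.
exact: pivots_twist_bot_unit.
Qed.

End ThetaCoord.

(** * The differential of the stacked twist map *)

Section DiffTheta.
Variables (R : realType) (k l n : nat) (n0 : (0 < n)%N).
Hypotheses (kn : (k <= n)%N) (ln : (l <= n)%N).

Local Notation E0 := ('M[R]_(k, n - k) * 'M[R]_(l, n - l))%type.
Implicit Type x : E0.

(** The differential of [stack_std], which is affine. *)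
Definition dstack_std x : 'M[R]_(k + l, n) :=
  col_mx (join_pivots kn 0 x.1) (join_pivots ln 0 x.2).

Lemma is_diff_entry1 x i j : is_diff x (fun y : E0 => y.1 i j) (fun v : E0 => v.1 i j).
Proof.
apply: is_diff_linear; first by move=> a u v; rewrite !mxE.
move=> y; apply: (@continuous_comp _ _ _ (fun y : E0 => y.1) (fun M => M i j)).
  exact: cvg_fst.
exact: coord_continuous.
Qed.

Lemma is_diff_entry2 x i j : is_diff x (fun y : E0 => y.2 i j) (fun v : E0 => v.2 i j).
Proof.
apply: is_diff_linear; first by move=> a u v; rewrite !mxE.
move=> y; apply: (@continuous_comp _ _ _ (fun y : E0 => y.2) (fun M => M i j)).
  exact: cvg_snd.
exact: coord_continuous.
Qed.

Lemma is_mdiff_std1 x : is_mdiff x (fun y : E0 => std_mx y.1) (fun v => join_pivots kn 0 v.1).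
Proof.
move=> a b; under eq_fun do rewrite (std_mxE kn) castmxE.
under [X in is_diff _ _ X]eq_fun do rewrite castmxE.
case: (split_ordP (cast_ord (esym (subnKC kn)) b)) => c /= ->.
  under eq_fun do rewrite row_mxEl; under [X in is_diff _ _ X]eq_fun do rewrite row_mxEl mxE.
  exact: is_diff_cst.
under eq_fun do rewrite row_mxEr; under [X in is_diff _ _ X]eq_fun do rewrite row_mxEr.
exact: is_diff_entry1.
Qed.

Lemma is_mdiff_std2 x : is_mdiff x (fun y : E0 => std_mx y.2) (fun v => join_pivots ln 0 v.2).
Proof.
move=> a b; under eq_fun do rewrite (std_mxE ln) castmxE.
under [X in is_diff _ _ X]eq_fun do rewrite castmxE.
case: (split_ordP (cast_ord (esym (subnKC ln)) b)) => c /= ->.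
  under eq_fun do rewrite row_mxEl; under [X in is_diff _ _ X]eq_fun do rewrite row_mxEl mxE.
  exact: is_diff_cst.
under eq_fun do rewrite row_mxEr; under [X in is_diff _ _ X]eq_fun do rewrite row_mxEr.
exact: is_diff_entry2.
Qed.

Lemma is_mdiff_stack_std x : is_mdiff x (@stack_std R k l n) dstack_std.
Proof.
move=> a b; rewrite /stack_std /dstack_std; case: (split_ordP a) => c ->.
  under eq_fun do rewrite col_mxEu; under [X in is_diff _ _ X]eq_fun do rewrite col_mxEu.
  exact: is_mdiff_std1.
under eq_fun do rewrite col_mxEd; under [X in is_diff _ _ X]eq_fun do rewrite col_mxEd.
exact: is_mdiff_std2.
Qed.

Lemma is_mdiff_window N (f df : E0 -> 'M[R]_(N, n)) x (j : int) r :
  is_mdiff x f df ->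
  is_mdiff x (fun y => window k (f y) j r) (fun v => window k (df v) j r).
Proof.
move=> fd a b; under eq_fun do rewrite (windowE _ n0).
under [X in is_diff _ _ X]eq_fun do rewrite (windowE _ n0).
exact: (is_diffZ (col_sign R k n (j + b%:Z)) (fd a (col_index n0 (j + b%:Z)))).
Qed.

Lemma is_mdiff_mdifferentiable N q (f df : E0 -> 'M[R]_(N, q)) x :
  is_mdiff x f df -> mdifferentiable f x.
Proof. by move=> fd i j; have [] := fd i j. Qed.

Lemma near_wprod r (f df : E0 -> 'M[R]_(r, n)) x : is_mdiff x f df ->
  wprod k (f x) != 0 -> \near x, wprod k (f x) != 0.
Proof.
move=> fd fx.
have dd : differentiable (fun y => wprod k (f y)) x.
  apply: differentiable_bigprod => i; apply: mdifferentiable_det.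
  apply: is_mdiff_mdifferentiable; apply: is_mdiff_window; exact: fd.
have c := differentiable_continuous dd.
exact: (c _ (open_nbhs_nbhs (conj (@open_neq R 0) fx))).
Qed.

(** Regularity at infinitely many integers reduces, by periodicity, to the
    nonvanishing of three polynomials. *)
Lemma near_regular x : regular x -> \near x, regular x.
Proof.
move=> [H1 H2 H3].
have h1 := (wprod_neq0P k n0 (stack_std x)).2 H1.
have h2 := (wprod_neq0P k n0 (std_mx x.1)).2 H2.
have h3 := (wprod_neq0P k n0 (std_mx x.2)).2 H3.
have := near_wprod (is_mdiff_stack_std x) h1.
have := near_wprod (is_mdiff_std1 x) h2.
have := near_wprod (is_mdiff_std2 x) h3.
by apply: filterS3 => y ? ? ?; split; apply/(wprod_neq0P k n0).
Qed.

Lemma is_mdiff_col_tr p q (c : 'I_q) (f df : E0 -> 'M[R]_(p, q)) x :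
  is_mdiff x f df -> is_mdiff x (fun y => (col c (f y))^T) (fun v => (col c (df v))^T).
Proof.
move=> fd i a; under eq_fun do rewrite !mxE.
by under [X in is_diff _ _ X]eq_fun do rewrite !mxE.
Qed.

Lemma mdifferentiable_twist x : regular x ->
  mdifferentiable (fun y : E0 => twist (stack_std y)) x.
Proof.
move=> rx a c; have [D0 _ _] := rx.
pose r := (-1) ^ c.+1%:Z *: first_row R (k + l).
pose f (y : E0) := r *m invmx (window k (stack_std y) (c.+1%:Z - l%:Z) (k + l)).
have fd : mdifferentiable f x.
  apply: mdifferentiable_mulmx; first exact: is_mdiff_mdifferentiable (is_mdiff_cst _ _).
  apply: mdifferentiable_invmx; first by rewrite unit_det_neq0; exact: D0.
  by apply: is_mdiff_mdifferentiable; apply: is_mdiff_window; exact: is_mdiff_stack_std.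
have fE : \near x, f x 0 a = twist (stack_std x) a c.
  move: (near_regular rx); apply: filterS => y [Dy _ _].
  rewrite [RHS]mxE (_ : twist_col (stack_std y) c.+1%:Z = (f y)^T) ?mxE//.
  apply: twist_col_uniq => //.
  by rewrite trmxK -mulmxA mulVmx ?mulmx1// unit_det_neq0; exact: Dy.
by have [] := is_diff_near fE (differentiableP (fd 0 a)).
Qed.

(** The differential is determined by differentiating the duality equations,
    once the twist is known to be differentiable. *)
Lemma is_mdiff_twist x : regular x ->
  is_mdiff x (fun y : E0 => twist (stack_std y)) (fun v => dtwist (stack_std x) (dstack_std v)).
Proof.
move=> rx; have [D0 _ _] := rx.
have := mdifferentiableP (mdifferentiable_twist rx).
set L := fun v => \matrix_(i, j) _ => Ld.
suff -> : (fun v => dtwist (stack_std x) (dstack_std v)) = L by [].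
apply/funext => v; apply: dtwist_uniq => // c; set j := c.+1%:Z - l%:Z.
have colE (y : E0) : (col c (twist (stack_std y)))^T = (twist_col (stack_std y) c.+1%:Z)^T.
  by apply/rowP => a; rewrite !mxE.
have fd := is_mdiff_mulmx (is_mdiff_col_tr c Ld)
  (is_mdiff_window j (r := (k + l)%N) (is_mdiff_stack_std x)).
have cd := is_mdiff_cst ((-1) ^ c.+1%:Z *: first_row R (k + l)) x.
have near_eq : \near x, (-1) ^ c.+1%:Z *: first_row R (k + l) =
    (col c (twist (stack_std x)))^T *m window k (stack_std x) j (k + l).
  by move: (near_regular rx); apply: filterS => y [Dy _ _]; rewrite colE twist_colP.
have /(congr1 (fun f => f v)) := is_mdiff_unique fd (is_mdiff_near near_eq cd).
by rewrite colE => /eqP; rewrite addr_eq0 => /eqP.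
Qed.

(** Differentiating [nonpivots W = pivots W *m F] gives the differential of the
    row reduction [F] without differentiating an inverse. *)
Lemma is_mdiff_reduce q r (rn : (r <= n)%N) (q' : 'I_r -> 'I_q)
    (Y dY : E0 -> 'M[R]_(q, n)) x :
  let W y := mxsub q' id (Y y) in let dW v := mxsub q' id (dY v) in
  let F y := invmx (pivots rn (W y)) *m nonpivots rn (W y) in
  is_mdiff x Y dY -> pivots rn (W x) \in unitmx ->
  (\near x, pivots rn (W x) \in unitmx) ->
  is_mdiff x F (fun v => invmx (pivots rn (W x)) *m
                  (nonpivots rn (dW v) - pivots rn (dW v) *m F x)).
Proof.
move=> W dW F Yd ux unear.
have Wd : is_mdiff x W dW by exact: is_mdiff_entries.
have Pd := is_mdiff_entries id (pivot rn) Wd.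
have Nd := is_mdiff_entries id (nonpivot rn) Wd.
have Fd : mdifferentiable F x.
  apply: mdifferentiable_mulmx; last exact: is_mdiff_mdifferentiable Nd.
  apply: mdifferentiable_invmx => //; exact: is_mdiff_mdifferentiable Pd.
have Ld := mdifferentiableP Fd; set L := (fun v => \matrix_(i, j) _) in Ld.
suff -> : (fun v => invmx (pivots rn (W x)) *m
                  (nonpivots rn (dW v) - pivots rn (dW v) *m F x)) = L by [].
have PFd := is_mdiff_mulmx Pd Ld.
have near_eq : \near x, nonpivots rn (W x) = pivots rn (W x) *m F x.
  by move: unear; apply: filterS => y uy; rewrite /F mulmxA mulmxV// mul1mx.
have e := is_mdiff_unique PFd (is_mdiff_near near_eq Nd).
apply/funext => v; have ev := congr1 (fun f => f v) e.
by rewrite -[nonpivots rn (dW v)]ev addrAC subrr add0r mulKmx.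
Qed.

Lemma diff_theta_coord x : regular x ->
  is_diff x (@theta_coord R k l n) (fun v =>
    let dY := dtwist (stack_std x) (dstack_std v) in
    (invmx (pivots kn (twist_top x)) *m
       (nonpivots kn (usubmx dY) - pivots kn (usubmx dY) *m (theta_coord x).1),
     invmx (pivots ln (twist_bot x)) *m
       (nonpivots ln (dsubmx dY) - pivots ln (dsubmx dY) *m (theta_coord x).2))).
Proof.
move=> rx; have Yd := is_mdiff_twist rx.
have uE : mxsub (lshift l) id = @usubmx R k l n.
  by apply/funext => M; apply/matrixP => i j; rewrite !mxE.
have dE : mxsub (@rshift k l) id = @dsubmx R k l n.
  by apply/funext => M; apply/matrixP => i j; rewrite !mxE.
have u1 : \near x, pivots kn (twist_top x) \in unitmx.
  by move: (near_regular rx); apply: filterS => y; exact: pivots_twist_top_unit.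
have u2 : \near x, pivots ln (twist_bot x) \in unitmx.
  by move: (near_regular rx); apply: filterS => y; exact: pivots_twist_bot_unit.
have d1 := @is_mdiff_reduce _ _ kn (lshift l) _ _ _ Yd.
have d2 := @is_mdiff_reduce _ _ ln (@rshift k l) _ _ _ Yd.
have nE : \near x, (invmx (pivots kn (twist_top x)) *m nonpivots kn (twist_top x),
   invmx (pivots ln (twist_bot x)) *m nonpivots ln (twist_bot x)) = theta_coord x.
  by move: (near_regular rx); apply: filterS => y ry; rewrite (theta_coordE n0 kn ln ry).
apply: is_diff_near nE _.
rewrite (theta_coordE n0 kn ln rx) /twist_top /twist_bot.
apply: is_diff_pair; apply: is_diff_of_is_mdiff.
  by rewrite uE in d1; exact: d1 (pivots_twist_top_unit n0 kn rx) u1.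
by rewrite dE in d2; exact: d2 (pivots_twist_bot_unit n0 ln rx) u2.
Qed.

End DiffTheta.

(** * Top forms as determinants *)

Section Volume.
Variable R : realType.

(** Laplace expansion along the first [p] columns, summed over all permutations
    instead of over subsets of rows; each pair of permutations [s], [r]
    contributes a term of [\det X] with a weight that depends on [r \o s] only.
    The constant [c], the number of permutations preserving both blocks, cancels
    in the comparison of two forms and is left unevaluated. *)
Lemma sum_complementary_minors p q : exists c : R, forall X : 'M[R]_(p + q),
  \sum_(s : 'S_(p + q)) (-1) ^+ s
     * \det (\matrix_(i < p, j < p) X (s (lshift q i)) (lshift q j))
     * \det (\matrix_(i < q, j < q) X (s (rshift p i)) (rshift p j)) = c * \det X.
Proof.
(* The mask of the two diagonal blocks. *)
pose m : 'M[R]_(p + q) := block_mx (const_mx 1) 0 0 (const_mx 1).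
exists (\sum_(s : 'S_(p + q)) \prod_i m i (s i)) => X.
transitivity (\sum_(s : 'S_(p + q)) \sum_(r : 'S_(p + q))
    (-1) ^+ s * ((-1) ^+ r * \prod_i (m i (r i) * X (s i) (r i)))).
  apply: eq_bigr => s _; rewrite -mulrA -mulr_sumr; congr (_ * _).
  rewrite -(det_ublock _ 0).
  rewrite [RHS](_ : _ = \det (\matrix_(i, j) (m i j * X (s i) j))); last first.
    by apply: eq_bigr => r _; congr (_ * _); apply: eq_bigr => i _; rewrite [RHS]mxE.
  congr (\det _); apply/matrixP => i j; rewrite [RHS]mxE /m.
  by case: (split_ordP i) => a ->; case: (split_ordP j) => b ->;
    rewrite ?(block_mxEul, block_mxEur, block_mxEdl, block_mxEdr) !mxE ?mul1r ?mul0r.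
transitivity (\sum_(s : 'S_(p + q)) \sum_(r : 'S_(p + q))
    (-1) ^+ r * \prod_i X i (r i) * \prod_i m i (r (s i))).
  apply: eq_bigr => s _; rewrite (reindex_inj (mulgI s)); apply: eq_bigr => r _.
  rewrite mulrA odd_permM signr_addb mulrA -expr2 sqrr_sign mul1r -mulrA; congr (_ * _).
  rewrite big_split /= mulrC; congr (_ * _).
    rewrite [RHS](reindex_inj (@perm_inj _ s)).
    by apply: eq_bigr => i _; rewrite permM.
  by apply: eq_bigr => i _; rewrite permM.
rewrite exchange_big mulr_sumr; apply: eq_bigr => r _.
rewrite -mulr_sumr mulrC; congr (_ * _).
rewrite [RHS](reindex_inj (mulIg r)); apply: eq_bigr => s _.
by apply: eq_bigr => i _; rewrite permM.
Qed.

Variables (k l n : nat).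
Local Notation E0 := ('M[R]_(k, n - k) * 'M[R]_(l, n - l))%type.
Let N := (k * (n - k) + l * (n - l))%N.

Definition coords (v : E0) : 'rV[R]_N := row_mx (mxvec v.1) (mxvec v.2).

Lemma det_coords (f : E0 -> E0) (v : 'I_N -> E0) : linear f ->
  \det (\matrix_i coords (f (v i))) = detl f * \det (\matrix_i coords (v i)).
Proof.
move=> lf.
pose c' (u : 'rV[R]_N) : E0 := (vec_mx (lsubmx u), vec_mx (rsubmx u)).
have lc : linear coords.
  by move=> a x y; rewrite /coords !linearP /= scale_row_mx add_row_mx.
have lc' : linear c' by move=> a x y; rewrite /c' !linearP.
have cK : cancel coords c'.
  by case=> a b; rewrite /c' /coords row_mxKl row_mxKr !mxvecK.
have c'K : cancel c' coords.
  by move=> u; rewrite /c' /coords /= !vec_mxK hsubmxK.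
have lg : linear (fun u => coords (f (c' u))) by move=> a x y; rewrite lc' lf lc.
have fE x : coords (f x) = coords x *m \matrix_i (coords (f (c' (delta_mx 0 i)))).
  by rewrite -(linear_rowE lg) cK.
rewrite (detl_coord lc lc' lf cK c'K fE) mulrC -det_mulmx; congr (\det _).
by apply/row_matrixP => i; rewrite row_mul !rowK.
Qed.

Lemma diff_fst (x v : E0) : 'd (fst : E0 -> _) x v = v.1.
Proof.
have [] // := @is_diff_linear R _ _ (fst : E0 -> _) x.
by move=> y; exact: cvg_fst.
by move=> _ ->.
Qed.

Lemma diff_snd (x v : E0) : 'd (snd : E0 -> _) x v = v.2.
Proof.
have [] // := @is_diff_linear R _ _ (snd : E0 -> _) x.
by move=> y; exact: cvg_snd.
by move=> _ ->.
Qed.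

Lemma omega_prodE : exists c : R, forall (x : E0) (v : 'I_N -> E0),
  @omega_prod R k l n x v =
  c * \det (\matrix_i coords (v i)) / (cyc_prod x.1 * cyc_prod x.2).
Proof.
have [c cP] := sum_complementary_minors (k * (n - k)) (l * (n - l)).
exists (((k * (n - k))`! * (l * (n - l))`!)%:R^-1 * c) => x v.
rewrite /omega_prod /wedge -!mulrA; congr (_ * _).
rewrite [RHS]mulrA -cP mulr_suml; apply: eq_bigr => s _.
rewrite /pullback /omega -!mulrA; congr (_ * _).
have -> : \matrix_(i < k * (n - k), j < k * (n - k))
      mxvec ('d (fst : E0 -> _) x (v (s (lshift _ i)))) 0 j =
    \matrix_(i < k * (n - k), j < k * (n - k))
      (\matrix_i coords (v i)) (s (lshift _ i)) (lshift (l * (n - l)) j).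
  by apply/matrixP => i j; rewrite [LHS]mxE diff_fst [RHS]mxE [RHS]mxE /coords row_mxEl.
have -> : \matrix_(i < l * (n - l), j < l * (n - l))
      mxvec ('d (snd : E0 -> _) x (v (s (rshift _ i)))) 0 j =
    \matrix_(i < l * (n - l), j < l * (n - l))
      (\matrix_i coords (v i)) (s (rshift _ i)) (rshift (k * (n - k)) j).
  by apply/matrixP => i j; rewrite [LHS]mxE diff_snd [RHS]mxE [RHS]mxE /coords row_mxEr.
by rewrite invfM; congr (_ * _); rewrite mulrCA.
Qed.

End Volume.

(** * The Jacobian of the stacked twist map *)

Section DetTheta.
Variables (R : realType) (k l n : nat) (n0 : (0 < n)%N).
Hypotheses (kn : (k <= n)%N) (ln : (l <= n)%N).

Local Notation E0 := ('M[R]_(k, n - k) * 'M[R]_(l, n - l))%type.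
Local Notation GL := ('M[R]_k * 'M[R]_l)%type.
Local Notation Q := (E0 * GL)%type.

Definition bdiag (g : GL) : 'M[R]_(k + l) := block_mx g.1 0 0 g.2.

Definition assemble (q : Q) : 'M[R]_(k + l, n) :=
  col_mx (join_pivots kn q.2.1 q.1.1) (join_pivots ln q.2.2 q.1.2).

Definition disassemble (M : 'M[R]_(k + l, n)) : Q :=
  ((nonpivots kn (usubmx M), nonpivots ln (dsubmx M)),
   (pivots kn (usubmx M), pivots ln (dsubmx M))).

Lemma assembleK : cancel assemble disassemble.
Proof.
case=> [[a b] [g h]]; rewrite /assemble /disassemble /= col_mxKu col_mxKd.
by rewrite !join_pivotsK !join_nonpivotsK.
Qed.

Lemma disassembleK : cancel disassemble assemble.
Proof.
move=> M; rewrite /assemble /disassemble /= -[RHS]vsubmxK; congr col_mx.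
  by apply: (pivotsP (rn := kn)); rewrite ?join_pivotsK ?join_nonpivotsK.
by apply: (pivotsP (rn := ln)); rewrite ?join_pivotsK ?join_nonpivotsK.
Qed.

Lemma disassemble_linear : linear disassemble.
Proof.
by move=> a x y; apply: injective_projections; apply: injective_projections;
  rewrite /=; apply/matrixP => i j; rewrite !mxE.
Qed.

Lemma assemble_linear : linear assemble.
Proof.
move=> a x y; apply: (can_inj disassembleK).
by rewrite disassemble_linear !assembleK.
Qed.

(** [assemble] of a sheared pair is the tangent vector at [stack_std x] with
    chart component [q.1] and component [q.2] along the orbit of GL_k x GL_l
    ([assemble_shear]). *)
Definition shear (x : E0) (q : Q) : Q :=
  ((q.1.1 + q.2.1 *m x.1, q.1.2 + q.2.2 *m x.2), q.2).

Lemma assemble_shear x q :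
  assemble (shear x q) = dstack_std kn ln q.1 + bdiag q.2 *m stack_std x.
Proof.
case: q => [[a b] [g h]]; apply: (can_inj disassembleK).
rewrite assembleK /shear /dstack_std /bdiag /stack_std mul_block_col !mul0mx add0r addr0.
rewrite add_col_mx /disassemble col_mxKu col_mxKd /=.
have pD r (rn : (r <= n)%N) p : {morph @pivots R r n rn p : x y / x + y}.
  by move=> M N; apply/matrixP => i j; rewrite !mxE.
have nD r (rn : (r <= n)%N) p : {morph @nonpivots R r n rn p : x y / x + y}.
  by move=> M N; apply/matrixP => i j; rewrite !mxE.
rewrite !pD !nD !join_pivotsK !join_nonpivotsK !pivots_mulmx !nonpivots_mulmx.
by rewrite !pivots_std !nonpivots_std !mulmx1 !add0r.
Qed.

Lemma shear_linear x : linear (shear x).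
Proof.
move=> a p q; apply: injective_projections => //; apply: injective_projections => /=;
  by rewrite mulmxDl -scalemxAl scalerDr addrACA.
Qed.

Lemma detl_shear x : detl (shear x) = 1.
Proof.
rewrite (@detl_pair_snd _ _ _ _ id)//; last exact: shear_linear.
rewrite detl_id mul1r -[RHS](detl_id E0); apply: eq_detl => v.
by apply: injective_projections; rewrite /= mul0mx addr0.
Qed.

(** The derivative at [g = 1] of the equivariance [twist_mulmx]. *)
Lemma dtwist_mulmx (U : 'M[R]_(k + l, n)) (g : 'M[R]_(k + l)) :
  (forall j : int, wdet k U j != 0) -> dtwist U (g *m U) = - (g^T *m twist U).
Proof.
move=> D0; apply: dtwist_uniq => // c.
rewrite window_mulmx// [in RHS]mulmxA -[in RHS]mulNmx; congr (_ *m _).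
apply/rowP => a; rewrite !mxE; congr (- _).
by apply: eq_bigr => b _; rewrite !mxE mulrC.
Qed.

Lemma reduce_pivots r (rn : (r <= n)%N) (G : 'M[R]_r) (W : 'M[R]_(r, n)) A :
  G \in unitmx ->
  G *m join_pivots rn (invmx G *m pivots rn W)
    (invmx G *m (nonpivots rn W - pivots rn W *m A) + invmx G *m pivots rn W *m A) = W.
Proof.
move=> uG; rewrite -mulmxA -mulmxDr subrK join_pivots_mulmx !mulKVmx//.
by apply: (pivotsP (rn := rn)); rewrite ?join_pivotsK ?join_nonpivotsK.
Qed.

Section AtPoint.
Variables (x : E0) (rx : regular x).
Let U := stack_std x.
Let G : GL := (pivots kn (twist_top x), pivots ln (twist_bot x)).
Let y := theta_coord x.
Let D (v : E0) : E0 := 'd (@theta_coord R k l n) x v.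
Let dY (v : E0) := dtwist U (dstack_std kn ln v).
Let C (v : E0) : GL := (invmx G.1 *m pivots kn (usubmx (dY v)),
                        invmx G.2 *m pivots ln (dsubmx (dY v))).
Let conj_tr (g : GL) : GL := (- (invmx G.1 *m g.1^T *m G.1), - (invmx G.2 *m g.2^T *m G.2)).
Let S (q : Q) : Q := (D q.1, C q.1 + conj_tr q.2).

Let uG1 : G.1 \in unitmx. Proof. exact: pivots_twist_top_unit. Qed.
Let uG2 : G.2 \in unitmx. Proof. exact: pivots_twist_bot_unit. Qed.
Let D0 : forall j : int, wdet k U j != 0. Proof. by case: rx. Qed.

Lemma twist_factor : twist U = bdiag G *m stack_std y.
Proof.
rewrite /bdiag /stack_std mul_block_col !mul0mx add0r addr0 -[LHS]vsubmxK /y.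
by rewrite (theta_coordE n0 kn ln rx); congr col_mx; exact: pivots_factor.
Qed.

(** In orbit coordinates at the source and at the target, the differential of
    the twist is [S], up to the factor [bdiag G] that brings the twist of
    [stack_std x] to chart form. *)
Lemma dtwist_shear q :
  dtwist U (assemble (shear x q)) = bdiag G *m assemble (shear y (S q)).
Proof.
case: q => v g; rewrite !assemble_shear /S /=.
have lT := dtwist_linear n0 U.
have TD (M M' : 'M[R]_(k + l, n)) : dtwist U (M + M') = dtwist U M + dtwist U M'.
  by have := lT 1 M M'; rewrite !scale1r.
rewrite TD -/U dtwist_mulmx// twist_factor mulmxA -mulNmx.
have -> : bdiag (C v + conj_tr g) = bdiag (C v) + bdiag (conj_tr g).
  by rewrite /bdiag add_block_mx !addr0.
rewrite mulmxDl addrA mulmxDr; congr (_ + _).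
  have De : D v =
      (invmx G.1 *m (nonpivots kn (usubmx (dY v)) - pivots kn (usubmx (dY v)) *m y.1),
       invmx G.2 *m (nonpivots ln (dsubmx (dY v)) - pivots ln (dsubmx (dY v)) *m y.2)).
    by have [_ e] := diff_theta_coord n0 kn ln rx; rewrite /D e.
  rewrite -/(dY v) -[LHS]vsubmxK -(assemble_shear y (D v, C v)) /assemble /bdiag.
  by rewrite mul_block_col !mul0mx addr0 add0r De /= !reduce_pivots.
rewrite mulmxA -[in RHS]mulmxA [RHS]mulmxA -mulNmx; congr (_ *m _).
rewrite /bdiag /conj_tr tr_block_mx !trmx0 !mulmx_block !(mulmx0, mul0mx, addr0, add0r) /=.
rewrite opp_block_mx !oppr0 mulmx_block !(mulmx0, mul0mx, addr0, add0r).
by rewrite !mulmxN !mulmxA (mulmxV uG1) (mulmxV uG2) !mul1mx !mulNmx.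
Qed.

Lemma diff_theta_linear : linear D.
Proof. by move=> a u v; rewrite /D linearP. Qed.

(** Shears have determinant 1 and [S] is block triangular, with [D] and
    [conj_tr] as diagonal blocks. *)
Lemma detl_diff_theta (e1 e2 : R) :
  detl (fun g : 'M[R]_k => - (invmx G.1 *m g^T *m G.1)) = e1 ->
  detl (fun g : 'M[R]_l => - (invmx G.2 *m g^T *m G.2)) = e2 ->
  detl (dtwist U) = (\det G.1 * \det G.2) ^+ n * (detl D * (e1 * e2)).
Proof.
move=> h1 h2.
have lT := dtwist_linear n0 U.
have ld := disassemble_linear; have la := assemble_linear.
have lG : linear (mulmx (bdiag G) : 'M[R]_(k + l, n) -> _).
  by move=> a u v; rewrite mulmxDr scalemxAr.
have lS2 : linear conj_tr.
  move=> a u v; apply: injective_projections; rewrite /= linearP /=;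
  by rewrite mulmxDr mulmxDl -scalemxAr -scalemxAl opprD scalerN.
have ldY : linear dY.
  move=> a u v; rewrite /dY -lT; congr (dtwist _ _).
  have dE w : dstack_std kn ln w = assemble (w, (0, 0)) by [].
  rewrite !dE -la; congr assemble.
  by apply: injective_projections => //; apply: injective_projections;
    rewrite /= scaler0 addr0.
have lC : linear C.
  have pu : linear (fun M : 'M[R]_(k + l, n) => pivots kn (usubmx M)).
    by move=> a u v; apply/matrixP => i j; rewrite !mxE.
  have pd : linear (fun M : 'M[R]_(k + l, n) => pivots ln (dsubmx M)).
    by move=> a u v; apply/matrixP => i j; rewrite !mxE.
  by move=> a u v; apply: injective_projections;
    rewrite /C ldY /= ?pu ?pd mulmxDr -scalemxAr.
have lS : linear S.
  move=> a u v; apply: injective_projections; rewrite /=; first exact: diff_theta_linear.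
  by rewrite lC lS2 scalerDr addrACA.
have <- : detl (disassemble \o dtwist U \o assemble) = detl (dtwist U).
  by apply: detl_conj => //; [exact: disassembleK|exact: assembleK].
have -> : (\det G.1 * \det G.2) ^+ n = detl (disassemble \o mulmx (bdiag G) \o assemble).
  rewrite detl_conj//; [|exact: disassembleK|exact: assembleK].
  by rewrite detl_mulmx_left det_ublock.
have -> : detl D * (e1 * e2) = detl S.
  rewrite (@detl_pair _ _ _ S D)//; last exact: diff_theta_linear.
  have C0 : C 0 = 0 by have := lC (-1) 0 0; rewrite scaler0 addr0 scaleN1r addNr.
  congr (_ * _); rewrite /= C0 -h1 -h2 -[RHS](eq_detl (f := conj_tr)); last first.
    by move=> g; rewrite add0r.
  rewrite (@detl_pair _ _ _ conj_tr (fun g => - (invmx G.1 *m g^T *m G.1)))//.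
  by move=> a u v; rewrite linearP /= mulmxDr mulmxDl -scalemxAr -scalemxAl opprD scalerN.
rewrite -[LHS]mulr1 -(detl_shear x) -[detl S]mul1r -(detl_shear y).
rewrite -!detl_comp//.
- by apply: eq_detl => q /=; rewrite dtwist_shear.
- by move=> a u v /=; rewrite la lG ld.
- exact: shear_linear.
- by move=> a u v /=; rewrite la lT ld.
Qed.
End AtPoint.

(** The Jacobian of the twist and the change of the cyclic minors are both, up
    to sign, governed by the square of the product [wprod k (stack_std x)];
    the powers of the determinants of the pivot blocks, which enter both through
    the passage to the charts, cancel. *)
Lemma detl_theta_cyc_prod : exists2 e : R, e = 1 \/ e = -1 & forall x : E0, regular x ->
  detl (fun v : E0 => 'd (@theta_coord R k l n) x v : E0) /
    (cyc_prod (theta_coord x).1 * cyc_prod (theta_coord x).2) =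
  e / (cyc_prod x.1 * cyc_prod x.2).
Proof.
have [e1 s1 E1] := detl_conj_trmx R k; have [e2 s2 E2] := detl_conj_trmx R l.
have [e3 s3 E3] := detl_dtwist R k l n0.
have [e4 s4 E4] := prod_Delta_twist_top R l n0 kn.
have [e5 s5 E5] := prod_Delta_twist_bot R k n0 ln.
have [e6 s6 E6] := prod_Delta_cyc R k n0 kn.
have [e7 s7 E7] := prod_Delta_cyc R k n0 ln.
exists (e1 * e2 * e3 * e4 * e5 * e6 * e7).
  by apply/pred2P; rewrite -sqrf_eq1 !exprMn s1 s2 s3 s4 s5 s6 s7 !mulr1.
move=> x rx; have [D0 D1 D2] := rx.
have u1 := pivots_twist_top_unit n0 kn rx.
have u2 := pivots_twist_bot_unit n0 ln rx.
have := detl_diff_theta rx (E1 _ u1) (E2 _ u2); rewrite E3//.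
have := E4 (std_mx x.1, std_mx x.2) D0; have := E5 (std_mx x.1, std_mx x.2) D0.
rewrite (theta_coordE n0 kn ln rx) /= -/(stack_std x) -/(twist_top x) -/(twist_bot x).
rewrite (prod_Delta_factor u1) (prod_Delta_factor u2).
have := E6 (std_mx x.1) I; have := E7 (std_mx x.2) I.
rewrite /= -/(cyc_prod x.1) -/(cyc_prod x.2) => -> ->.
have w0 : wprod k (stack_std x) != 0 by apply/(wprod_neq0P k n0).
have w10 : wprod k (std_mx x.1) != 0 by apply/(wprod_neq0P k n0).
have w20 : wprod k (std_mx x.2) != 0 by apply/(wprod_neq0P k n0).
rewrite exprMn; set d := detl _; move: w0 w10 w20.
move: (wprod k (stack_std x)) (wprod k (std_mx x.1)) (wprod k (std_mx x.2)).
move: (_ ^+ n) (_ ^+ n) (cyc_prod _) (cyc_prod _).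
move=> g1 g2 c1 c2 w w1 w2 w0 w10 w20 h1 h2 h3.
have w1E : w1 = e5 * (g2 * c2 * w) by rewrite h1 mulrA -expr2 s5 mul1r.
have w2E : w2 = e4 * (g1 * c1 * w) by rewrite h2 mulrA -expr2 s4 mul1r.
have [c10 c20] : c1 != 0 /\ c2 != 0.
  split; [move: w20; rewrite w2E|move: w10; rewrite w1E];
  by rewrite !mulf_eq0 !negb_or => /and3P[_ /andP[]].
(* Signs are their own inverses. *)
have h4 : g1 * g2 * d * w ^+ 2 = e1 * e2 * e3.
  have -> : e3 = g1 * g2 * (d * (e1 * e2)) * w ^+ 2.
    by rewrite -h3 divfK// expf_neq0.
  transitivity (e1 ^+ 2 * e2 ^+ 2 * (g1 * g2 * d * w ^+ 2)); last by ring.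
  by rewrite s1 s2 !mul1r.
have c12 : c1 * c2 != 0 by rewrite mulf_neq0.
have w12 : e6 * w1 * (e7 * w2) != 0 by rewrite !mulf_neq0// sign_neq0.
apply/eqP; rewrite eqr_div//; apply/eqP; rewrite w1E w2E.
transitivity (g1 * g2 * d * w ^+ 2 * e4 * e5 * e6 * e7 * (c1 * c2)); first by ring.
by rewrite h4; ring.
Qed.
End DetTheta.

Theorem theorem5p9 (R : realType) (k l m n : nat)
    (hn : (2 <= n)%N) (hm : ~~ odd m) (hklm : (k + l + m)%N = n) :
  exists2 e : R, e = 1 \/ e = -1 &
    forall x : 'M[R]_(k, n - k) * 'M[R]_(l, n - l),
      theta_dom k l (chart2 x) ->
      cyc_prod x.1 != 0 -> cyc_prod x.2 != 0 ->
      forall v : 'I_(k * (n - k) + l * (n - l)) ->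
                   'M[R]_(k, n - k) * 'M[R]_(l, n - l),
        pullback (@theta_coord R k l n) (@omega_prod R k l n) x v
        = e * @omega_prod R k l n x v.
Proof.
have n0 : (0 < n)%N by exact: leq_trans hn.
have kn : (k <= n)%N by rewrite -hklm -addnA leq_addr.
have ln : (l <= n)%N by rewrite -hklm addnAC leq_addl.
have [e e1 eP] := detl_theta_cyc_prod R n0 kn ln.
have [c cP] := omega_prodE R k l n.
exists e => // x dx x1 x2 v.
have rx := regular_theta_dom n0 kn ln dx x1 x2.
have vol := eP x rx.
rewrite /pullback !cP det_coords; last by move=> a u w; rewrite linearP.
set D := \det _; rewrite [detl _ * D]mulrC [c * (D * _)]mulrA.
rewrite [e * _]mulrCA -[LHS]mulrA; congr (_ * _).
exact: vol.
Qed.
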